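(* The fibration $\Pi:Q^5\to M^4$, $(\mathbf q,\mathbf p)\mapsto([\mathbf q],[\mathbf p])$, establishes a bijection between integral curves of $(Q^5,\mathcal D)$ and non-degenerate null curves in $(M^4,[\mathbf g])$ with parallel self-dual tangent null 2-plane.
   Context: Elements of $\mathbb R^3$ are columns $\mathbf q$, elements of $(\mathbb R^3)^*$ are rows $\mathbf p$, $\mathbf p\mathbf q=p_iq^i$, $(\mathbf v\times\mathbf w)_i=\epsilon_{ijk}v^jw^k$ for $\mathbf v,\mathbf w\in\mathbb R^3$. $Q^5=\{(\mathbf q,\mathbf p)\mid\mathbf p\mathbf q=1\}\subset\mathbb R^3\oplus(\mathbb R^3)^*$; $\mathcal D\subset TQ^5$ is the rank 2 distribution $\ker(d\mathbf p-\mathbf q\times d\mathbf q)$ on $Q^5$. An integral curve is a regular (nowhere vanishing velocity) curve $(\mathbf q(t),\mathbf p(t))$ in $Q^5$ tangent to $\mathcal D$, i.e. $\mathbf p'=\mathbf q\times\mathbf q'$. $\mathbb{RP}^2=\mathbb P(\mathbb R^3)$, $\mathbb{RP}^{2*}=\mathbb P((\mathbb R^3)^* )$, and $M^4\subset\mathbb{RP}^2\times\mathbb{RP}^{2*}$ is the open set of non-incident pairs $([\mathbf q],[\mathbf p])$, $\mathbf p\mathbf q\ne0$. $\Pi:Q^5\to M^4$ is a principal $\mathbb R^*$-bundle for the action $(\mathbf q,\mathbf p)\mapsto(\lambda\mathbf q,\mathbf p/\lambda)$. The dancing metric $\mathbf g$ on $M^4$ is the unique pseudo-riemannian metric (of signature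 $(2,2)$) making $\Pi$ a pseudo-riemannian submersion, where $Q^5$ carries the restriction of the flat metric $-2\,d\mathbf p\,d\mathbf q$; $[\mathbf g]$ is its conformal class. $M^4$ is oriented by declaring bases of the form $(v_1,v_2,Kv_1,Kv_2)$ positive, where $K(q',p')=(q',-p')$ on $T_{(q,p)}M=T_q\mathbb{RP}^2\oplus T_p\mathbb{RP}^{2*}$. A curve $\Gamma(t)=(q(t),p(t))$ in $M^4$ is non-degenerate if $q'(t)\ne0$ and $p'(t)\neq0$ for all $t$; it is null if $\mathbf g(\Gamma',\Gamma')=0$. A 2-plane $W\subset T_mM$ is null if $\mathbf g|_W=0$; it is self-dual (SD) if $\theta^1\wedge\theta^2$ is a self-dual 2-form ($*=+1$) for a basis $\theta^1,\theta^2$ of its annihilator, and anti-self-dual (ASD) if this form is anti-self-dual. Every null line is contained in exactly one SD null 2-plane and one ASD null 2-plane; hence along a null curve there is a well-defined SD tangent null 2-plane field (the SD null 2-plane containing the velocity). ''Parallel'' means parallel along the curve with respect to the Levi-Civita connection of $\mathbf g$.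
   Formalization: The orientation of M^4 is fixed by bases (v1,v2,Kv1,Kv2) with v1,v2 orthonormal, g(v1,v1)=g(v2,v2)=1 and g(v1,v2)=0; without such a condition bases of this form have both orientations, so ''self-dual'' would be undefined. *)

(* Defs.v *)
From HB Require Import structures.
From mathcomp Require Import all_boot all_order all_algebra.
From mathcomp Require Import all_classical all_reals all_analysis.

Set Implicit Arguments.
Unset Strict Implicit.
Unset Printing Implicit Defensive.

Import Order.TTheory GRing.Theory Num.Theory.
Import numFieldNormedType.Exports.

Local Open Scope classical_set_scope.
Local Open Scope ring_scope.

(* The Levi-Civita symbol: the sign of f if f is a permutation, 0 otherwise. *)
Definition levi_civita (R : realType) (n : nat) (f : 'I_n -> 'I_n) : R :=
  \det (\matrix_(a, b) (f a == b)%:R).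

Definition smooth_on (R : realType) (V : normedModType R) (J : set R)
    (f : R -> V) : Prop :=
  forall n t, J t -> derivable (derive1n n f) t 1.

(* Tangent vectors are rows, covectors are columns, and a metric is a function *)
(* G sending a point to the matrix of its coefficients.                        *)

Section Coordinates.
Variables (R : realType) (n : nat).
Implicit Types (G : 'rV[R]_n -> 'M[R]_n) (g : 'M[R]_n) (z v w : 'rV[R]_n).

Definition inner g v w : R := (v *m g *m w^T) 0 0.

Definition partial (i : 'I_n) (f : 'rV[R]_n -> R) z : R :=
  'D_(delta_mx 0 i) f z.

Definition christoffel G z (k i j : 'I_n) : R :=
  2^-1 * \sum_l invmx (G z) k l *
    (partial i (fun y => G y j l) z + partial j (fun y => G y i l) z
     - partial l (fun y => G y i j) z).

(* Covariant derivative of a vector field V along a curve c. *)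
Definition cov_deriv G (c V : R -> 'rV[R]_n) (t : R) : 'rV[R]_n :=
  \row_k (derive1 V t 0 k +
    \sum_i \sum_j christoffel G (c t) k i j * derive1 c t 0 i * V t 0 j).

Definition parallel_along G (J : set R) (c : R -> 'rV[R]_n)
    (W : R -> {vspace 'rV[R]_n}) : Prop :=
  forall V : R -> 'rV[R]_n, smooth_on J V -> (forall t, J t -> V t \in W t) ->
  forall t, J t -> cov_deriv G c V t \in W t.

Definition wedge (th1 th2 : 'cV[R]_n) : 'M[R]_n := th1 *m th2^T - th2 *m th1^T.

Definition annihilates (th : 'cV[R]_n) (W : {vspace 'rV[R]_n}) : Prop :=
  forall v, v \in W -> v *m th = 0.

Definition annihilator_basis (th1 th2 : 'cV[R]_n) (W : {vspace 'rV[R]_n})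
    : Prop :=
  free [:: th1; th2] /\
  (forall th, annihilates th W <-> th \in <<[:: th1; th2]>>%VS).

Definition null_plane g (W : {vspace 'rV[R]_n}) : Prop :=
  \dim W = 2%N /\ (forall v w, v \in W -> w \in W -> inner g v w = 0).

End Coordinates.

Section Dancing.
Variable R : realType.

Definition ambient := ('cV[R]_3 * 'rV[R]_3)%type.

Definition pairing (p : 'rV[R]_3) (q : 'cV[R]_3) : R := (p *m q) 0 0.

Definition cross (v w : 'cV[R]_3) : 'rV[R]_3 :=
  \row_i \sum_j \sum_k levi_civita R (tnth [tuple i; j; k]) * v j 0 * w k 0.

Definition Q5 : set ambient := [set Q | pairing Q.2 Q.1 = 1].

Definition TQ5 (Q : ambient) : set ambient :=
  [set u | pairing u.2 Q.1 + pairing Q.2 u.1 = 0].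

Definition distr (Q : ambient) : set ambient :=
  [set u | TQ5 Q u /\ u.2 = cross Q.1 u.1].

Definition velocity (gam : R -> ambient) (t : R) : ambient :=
  (derive1 (fst \o gam) t, derive1 (snd \o gam) t).

Definition integral_curve (I : set R) (gam : R -> ambient) : Prop :=
  [/\ smooth_on I (fst \o gam), smooth_on I (snd \o gam) &
      forall t, I t ->
        [/\ Q5 (gam t), velocity gam t != 0 & distr (gam t) (velocity gam t)]].

(* Points of RP^2 and RP^2* are the one-dimensional subspaces. *)
Definition planes := ({vspace 'cV[R]_3} * {vspace 'rV[R]_3})%type.

Definition M4 : set planes :=
  [set m | [/\ \dim m.1 = 1%N, \dim m.2 = 1%N &
     exists q p, [/\ q \in m.1, p \in m.2 & pairing p q != 0]]].

Definition Pi (Q : ambient) : planes := (<[Q.1]>%VS, <[Q.2]>%VS).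

Definition homog (i : 'I_3) (x : 'rV[R]_2) : 'rV[R]_3 :=
  \row_k (if unlift i k is Some l then x 0 l else 1).

(* Chart coordinates are z = (x, y), with x (resp. y) affine coordinates on    *)
(* the open set where the i-th homogeneous coordinate of q (resp. p) is not 0. *)
(* If p q != 0 then p_i q^i != 0 for some i, hence these three charts cover    *)
(* M^4 (lemma M4_charts below).                                                *)
Definition chart_q (i : 'I_3) (z : 'rV[R]_(2 + 2)) : 'cV[R]_3 :=
  (homog i (lsubmx z))^T.

Definition chart_p (i : 'I_3) (z : 'rV[R]_(2 + 2)) : 'rV[R]_3 :=
  homog i (rsubmx z).

Definition chart_dom (i : 'I_3) : set 'rV[R]_(2 + 2) :=
  [set z | pairing (chart_p i z) (chart_q i z) != 0].

Definition chart (i : 'I_3) (z : 'rV[R]_(2 + 2)) : planes :=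
  (<[chart_q i z]>%VS, <[chart_p i z]>%VS).

Lemma homogP (i : 'I_3) (p : 'rV[R]_3) : p 0 i != 0 ->
  homog i (\row_l (p 0 (lift i l) / p 0 i)) = (p 0 i)^-1 *: p.
Proof.
move=> pi0; apply/rowP => k; rewrite !mxE.
case: unliftP => [l ->|->]; last by rewrite mulVf.
by rewrite !mxE mulrC.
Qed.

Lemma homog_neq0 (i : 'I_3) (x : 'rV[R]_2) : homog i x != 0.
Proof.
apply/eqP => /rowP /(_ i); rewrite !mxE unlift_none.
by move/eqP; rewrite oner_eq0.
Qed.

Lemma M4_charts (m : planes) :
  M4 m <-> exists i z, chart_dom i z /\ m = chart i z.
Proof.
split=> [|[i [z [dz ->]]]]; last first.
  split; first by rewrite /= dim_vline trmx_eq0 homog_neq0.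
    by rewrite /= dim_vline homog_neq0.
  by exists (chart_q i z), (chart_p i z); rewrite !memv_line.
case: m => L N [/= dL dN [q [p [qL pN pq]]]].
have [i pqi] : exists i, p 0 i * q i 0 != 0.
  apply/existsP; apply: contraNT pq => /existsPn /= h.
  rewrite /pairing mxE big1 // => i _.
  by have := h i; rewrite negbK => /eqP.
move: (pqi); rewrite mulf_eq0 negb_or => /andP[pi0 qi0].
have qi0' : q^T 0 i != 0 by rewrite mxE.
pose z : 'rV[R]_(2 + 2) := row_mx
  (\row_l (q^T 0 (lift i l) / q^T 0 i)) (\row_l (p 0 (lift i l) / p 0 i)).
have zq : chart_q i z = (q i 0)^-1 *: q.
  by rewrite /chart_q row_mxKl homogP // linearZ /= trmxK mxE.
have zp : chart_p i z = (p 0 i)^-1 *: p by rewrite /chart_p row_mxKr homogP.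
have lineE (V : vectType R) (U : {vspace V}) u a :
    \dim U = 1%N -> u \in U -> u != 0 -> a != 0 -> U = <[a^-1 *: u]>%VS.
  move=> dU uU u0 a0; apply/esym/eqP; rewrite eqEdim dU dim_vline.
  by rewrite scaler_eq0 invr_eq0 (negPf a0) (negPf u0) /= -memvE memvZ.
exists i, z; split.
  rewrite /chart_dom /= /pairing zp zq -scalemxAl -scalemxAr !mxE.
  by rewrite !mulf_neq0 ?invr_eq0 //; move: pq; rewrite /pairing mxE.
rewrite /chart zq zp -(lineE _ L) // -?(lineE _ N) //.
  by apply: contraNneq pi0 => ->; rewrite mxE.
by apply: contraNneq qi0 => ->; rewrite mxE.
Qed.

Definition local_section (i : 'I_3) (z : 'rV[R]_(2 + 2)) : ambient :=
  (chart_q i z, (pairing (chart_p i z) (chart_q i z))^-1 *: chart_p i z).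

Lemma local_sectionP (i : 'I_3) (z : 'rV[R]_(2 + 2)) : chart_dom i z ->
  Q5 (local_section i z) /\ Pi (local_section i z) = chart i z.
Proof.
rewrite /chart_dom /= => dz; split.
  by rewrite /Q5 /= /pairing -scalemxAl mxE mulVf.
congr (_, _); apply/eqP; rewrite eqEdim !dim_vline scaler_eq0 invr_eq0 (negPf dz).
by rewrite leqnn andbT -memvE memvZ ?memv_line.
Qed.

Definition dsection (i : 'I_3) (z v : 'rV[R]_(2 + 2)) : ambient :=
  ('D_v (fst \o local_section i) z, 'D_v (snd \o local_section i) z).

(* The polar form of - 2 dp dq. *)
Definition flat (u w : ambient) : R := - (pairing u.2 w.1 + pairing w.2 u.1).

(* Generator at Q of the action (q, p) |-> (a q, p / a), derived at a = 1. *)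
Definition vertical (Q : ambient) : ambient := (Q.1, - Q.2).

Definition horizontal (Q u : ambient) : ambient :=
  u - (flat u (vertical Q) / flat (vertical Q) (vertical Q)) *: vertical Q.

(* Pi is a pseudo-riemannian submersion: the product of two tangent vectors of *)
(* M^4 is that of their horizontal lifts. The lift of v is obtained from any   *)
(* tangent vector of Q^5 above v by removing its vertical component.           *)
Definition dancing_metric (i : 'I_3) (z : 'rV[R]_(2 + 2)) : 'M[R]_(2 + 2) :=
  let lift v := horizontal (local_section i z) (dsection i z v) in
  \matrix_(a, b) flat (lift (delta_mx 0 a)) (lift (delta_mx 0 b)).

Definition paraK (v : 'rV[R]_(2 + 2)) : 'rV[R]_(2 + 2) :=
  row_mx (lsubmx v) (- rsubmx v).

(* Without a condition on v1 and v2, bases (v1, v2, K v1, K v2), K = paraK, of *)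
(* both orientations exist: replace (v1, v2) = ((e1, f1), (e2, f2)) by         *)
(* ((e1, f1), (e2, - f2)). They all have the same orientation when v1 and v2   *)
(* span a positive definite plane, in particular when they are orthonormal.    *)
Definition positively_oriented (g E : 'M[R]_(2 + 2)) : Prop :=
  exists v1 v2,
    [/\ inner g v1 v1 = 1, inner g v2 v2 = 1, inner g v1 v2 = 0 &
        0 < \det E * \det (col_mx (col_mx v1 v2) (col_mx (paraK v1) (paraK v2)))].

Definition orientation_sign (g : 'M[R]_(2 + 2)) : R :=
  if `[< positively_oriented g 1%:M >] then 1 else -1.

(* ( *om )_ij = 1/2 sqrt |det g| om^kl eps_klij for a positively oriented      *)
(* coordinate frame.                                                           *)
Definition hodge (g om : 'M[R]_(2 + 2)) : 'M[R]_(2 + 2) :=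
  let om_up := invmx g *m om *m (invmx g)^T in
  \matrix_(i, j) (orientation_sign g * (Num.sqrt `|\det g| / 2) *
    \sum_k \sum_l om_up k l * levi_civita R (tnth [tuple k; l; i; j])).

Definition SD_null_plane (g : 'M[R]_(2 + 2)) (W : {vspace 'rV[R]_(2 + 2)})
    : Prop :=
  null_plane g W /\
  exists th1 th2, annihilator_basis th1 th2 W /\
    hodge g (wedge th1 th2) = wedge th1 th2.

Definition chart_rep (Gam : R -> planes) (i : 'I_3) (J : set R)
    (c : R -> 'rV[R]_(2 + 2)) : Prop :=
  [/\ open J, smooth_on J c &
      forall t, J t -> chart_dom i (c t) /\ Gam t = chart i (c t)].

Definition smooth_curve (I : set R) (Gam : R -> planes) : Prop :=
  forall t, I t -> M4 (Gam t) /\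
    exists i J c, [/\ J t, J `<=` I & chart_rep Gam i J c].

Definition nondegenerate (I : set R) (Gam : R -> planes) : Prop :=
  forall i J c, J `<=` I -> chart_rep Gam i J c ->
  forall t, J t -> lsubmx (derive1 c t) != 0 /\ rsubmx (derive1 c t) != 0.

Definition null_curve (I : set R) (Gam : R -> planes) : Prop :=
  forall i J c, J `<=` I -> chart_rep Gam i J c ->
  forall t, J t -> inner (dancing_metric i (c t)) (derive1 c t) (derive1 c t) = 0.

Definition parallel_SD_plane (I : set R) (Gam : R -> planes) : Prop :=
  forall i J c, J `<=` I -> chart_rep Gam i J c ->
  exists W : R -> {vspace 'rV[R]_(2 + 2)},
    (forall t, J t ->
       SD_null_plane (dancing_metric i (c t)) (W t) /\ derive1 c t \in W t) /\
    parallel_along (dancing_metric i) J c W.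

Definition nondegenerate_null_curve_with_parallel_SD_plane (I : set R)
    (Gam : R -> planes) : Prop :=
  [/\ smooth_curve I Gam, nondegenerate I Gam, null_curve I Gam &
      parallel_SD_plane I Gam].

End Dancing.

(* Main.v *)
Require Import Defs.
From mathcomp Require Import all_boot all_order all_algebra.
From mathcomp Require Import all_classical all_reals all_analysis.
From mathcomp Require Import ring lra.
Import Order.TTheory GRing.Theory Num.Theory.
Import numFieldNormedType.Exports.
Local Open Scope classical_set_scope.
Local Open Scope ring_scope.

Set Implicit Arguments.
Unset Strict Implicit.
Unset Printing Implicit Defensive.

(* Work in an affine chart z = (x, y) with q = (x, 1), p = (y, 1) and rho = p q = 1 + x.y.
   The dancing metric is then - d_x d_y ln rho, so its only Christoffel symbols are those of
   the two projectively flat connections x'' - 2 (y.x') x' / rho and y'' - 2 (x.y') y' / rho.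
   The self-dual null planes transverse to the factors are the graphs y' = k Phi(x'), where
   Phi(x') is q * x' (cross product) modulo p, and a field of such planes along a curve is
   parallel iff k' = k (k a - 2 (y.x') / rho) with a = x_1 x'_0 - x_0 x'_1; testing the
   velocity alone already gives this equation.
   A lift Q = mu q, P = p / (mu rho) satisfies P' = Q * Q' iff k = +- mu^3 rho and
   mu' / mu = - (y.x') / rho, and these two conditions are compatible exactly when the
   equation for k holds. So the lift exists and is unique: mu is the real cube root of
   +- k / rho, with no differential equation to solve, and local lifts agree where they
   overlap. *)

(** Compatibility of the two conditions on mu: on the graph y' = k Phi(x') one has x.y' = k rho a,
    hence rho' = y.x' + k rho a. With mu' / mu = - (y.x') / rho, the logarithmic derivative of k =
    +- mu^3 rho is then k' / k = k a - 2 (y.x') / rho, the equation of parallel planes. A chart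
    contains points with rho < 0 as well as rho > 0, while the Hodge star involves sqrt |det g| and
    an orientation given by the existence of a frame. As det g = rho^-6 and the orientation sign of
    the coordinates is that of rho, the two combine into rho^-3, so self-duality is a single
    rational condition on the whole chart. The self-dual null planes at a point form a projective
    line, of which x' = 0 is the only member that is not a graph; non-degeneracy excludes it, and
    excludes k = 0 as well. *)

(** * Smoothness on open sets, differentiation rules and the real cube root *)

Section Calculus.
Context {R : realType}.
Implicit Types (J : set R) (f g : R -> R).

(** Recursing on [derive1 f], instead of iterating derivatives from outside as [smooth_on] does,
    lets the closure properties below go by induction on n. *)
Fixpoint diff_class (V : normedModType R) (n : nat) J (f : R -> V) : Prop :=
  if n is n'.+1 then
    (forall t, J t -> derivable f t 1) /\ diff_class n' J (derive1 f)
  else True.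

Lemma smooth_onE (V : normedModType R) J (f : R -> V) :
  smooth_on J f <-> forall n, diff_class n J f.
Proof.
split=> [sf n|df n].
  elim: n f sf => //= n IH f sf; split; first exact: sf 0%N.
  by apply: IH => m t Jt; have := sf m.+1 t Jt; rewrite derive1Sn.
elim: n f df => [|n IH] f df t Jt; first by have [+ _] := df 1%N; exact.
by rewrite derive1Sn; apply: IH Jt => m; have [] := df m.+1.
Qed.

Lemma eq_open_near (T : Type) J (f g : R -> T) t :
  open J -> {in J, f =1 g} -> J t -> \forall s \near t, f s = g s.
Proof.
move=> oJ fg Jt; apply: filterS (open_nbhs_nbhs (conj oJ Jt)) => s Js.
by apply: fg; rewrite inE.
Qed.

Lemma eq_derive1 (V : normedModType R) J (f g : R -> V) t :
  open J -> {in J, f =1 g} -> J t -> derive1 f t = derive1 g t.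
Proof.
by move=> oJ fg Jt; rewrite !derive1E; exact/near_eq_derive/(eq_open_near oJ).
Qed.

Lemma eq_derivable (V : normedModType R) J (f g : R -> V) t :
  open J -> {in J, f =1 g} -> J t -> derivable f t 1 -> derivable g t 1.
Proof. by move=> oJ fg Jt; exact/near_eq_derivable/(eq_open_near oJ). Qed.

Lemma eq_diff_class (V : normedModType R) n J (f g : R -> V) :
  open J -> {in J, f =1 g} -> diff_class n J f -> diff_class n J g.
Proof.
move=> oJ; elim: n f g => //= n IH f g fg [df cf]; split=> [t Jt|].
  exact: (eq_derivable oJ fg Jt (df t Jt)).
by apply: IH cf => t /[!inE] Jt; exact: eq_derive1 Jt.
Qed.

Lemma eq_smooth_on (V : normedModType R) J (f g : R -> V) :
  open J -> {in J, f =1 g} -> smooth_on J f -> smooth_on J g.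
Proof.
by move=> oJ fg /smooth_onE sf; apply/smooth_onE => n; exact: eq_diff_class (sf n).
Qed.

Lemma smooth_on_sub (V : normedModType R) J J' (f : R -> V) :
  J' `<=` J -> smooth_on J f -> smooth_on J' f.
Proof. by move=> sJ sf n t /sJ; exact: sf. Qed.

Lemma smooth_on_derivable (V : normedModType R) J (f : R -> V) (t : R) :
  smooth_on J f -> J t -> derivable f t 1.
Proof. by move=> /(_ 0%N); exact. Qed.

Lemma smooth_on_derive1 (V : normedModType R) J (f : R -> V) :
  smooth_on J f -> smooth_on J (derive1 f).
Proof. by move=> sf n t Jt; rewrite -derive1Sn; exact: sf. Qed.

Lemma diff_classW (V : normedModType R) n J (f : R -> V) :
  diff_class n.+1 J f -> diff_class n J f.
Proof. by elim: n f => //= n IH f [df cf]; split=> //; exact: IH. Qed.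

Lemma derive1_mxE m n (M : R -> 'M[R]_(m, n)) t i j :
  derivable M t 1 -> derive1 M t i j = derive1 (fun s => M s i j) t.
Proof. by move=> dM; rewrite !derive1E derive_mx // mxE. Qed.

Lemma diff_class_mx m n k J (M : R -> 'M[R]_(m, n)) : open J ->
  diff_class k J M <-> forall i j, diff_class k J (fun t => M t i j).
Proof.
move=> oJ; elim: k M => //= k IH M; split=> [[dM cM] i j|cM].
  split=> [t Jt|]; first exact/(iffLR (derivable_mxP M t 1))/dM.
  apply: (@eq_diff_class _ _ _ (fun t => derive1 M t i j)) => //.
    by move=> t /[!inE] Jt; exact/derive1_mxE/dM.
  exact: (iffLR (IH _)).
have dM t : J t -> derivable M t 1.
  by move=> Jt; apply/derivable_mxP => i j; have [+ _] := cM i j; exact.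
split=> //; apply/IH => i j; have [_] := cM i j; apply: eq_diff_class => //.
by move=> t /[!inE] Jt; exact/esym/derive1_mxE/dM.
Qed.

Lemma smooth_on_mx m n J (M : R -> 'M[R]_(m, n)) : open J ->
  smooth_on J M <-> forall i j, smooth_on J (fun t => M t i j).
Proof.
move=> oJ; split=> [/smooth_onE sM i j|sM].
  by apply/smooth_onE => k; move: i j; apply/diff_class_mx.
by apply/smooth_onE => k; apply/diff_class_mx => // i j; exact: (iffLR (smooth_onE _ _)).
Qed.

Section Rules.
Context {V : normedModType R}.
Implicit Types (h : V -> R) (x v : V).

Lemma is_derive_addf h1 h2 x v d1 d2 : is_derive x v h1 d1 ->
  is_derive x v h2 d2 -> is_derive x v (fun y => h1 y + h2 y) (d1 + d2).
Proof. exact: is_deriveD. Qed.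

Lemma is_derive_oppf h x v d : is_derive x v h d ->
  is_derive x v (fun y => - h y) (- d).
Proof. exact: is_deriveN. Qed.

Lemma is_derive_mulf h1 h2 x v d1 d2 : is_derive x v h1 d1 ->
  is_derive x v h2 d2 ->
  is_derive x v (fun y => h1 y * h2 y) (h1 x * d2 + h2 x * d1).
Proof. exact: is_deriveM. Qed.

Lemma is_derive_invf h x v d : h x != 0 -> is_derive x v h d ->
  is_derive x v (fun y => (h y)^-1) (- (h x) ^- 2 * d).
Proof.
move=> hx [dh <-]; apply: DeriveDef; first exact: derivableV.
by rewrite deriveV.
Qed.

End Rules.

Lemma is_derive_derive1 (V : normedModType R) (f : R -> V) (t : R) :
  derivable f t 1 -> is_derive t 1 f (derive1 f t).
Proof. by move=> df; rewrite derive1E; exact: derivableP. Qed.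

Lemma is_derive_derive1E (V : normedModType R) (f : R -> V) (t : R) d :
  is_derive t 1 f d -> derive1 f t = d.
Proof. by move=> [_ <-]; rewrite derive1E. Qed.

Lemma is_derive_derivable (V W : normedModType R) (f : V -> W) x v d :
  is_derive x v f d -> derivable f x v.
Proof. by case. Qed.

Lemma diff_class_cst n J (a : R) : diff_class n J (fun _ => a).
Proof.
elim: n a => //= n IH a; split=> [t _|]; first exact: derivable_cst.
by rewrite (_ : derive1 _ = fun=> 0) //; apply/funext => t; rewrite derive1_cst.
Qed.

Lemma diff_classD n J f g : open J ->
  diff_class n J f -> diff_class n J g -> diff_class n J (fun t => f t + g t).
Proof.
move=> oJ; elim: n f g => //= n IH f g [df cf] [dg cg]; split=> [t Jt|].
  exact: derivableD (df t Jt) (dg t Jt).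
apply: eq_diff_class (IH _ _ cf cg) => //.
move=> t /[!inE] Jt; apply/esym/is_derive_derive1E/is_derive_addf.
  exact/is_derive_derive1/df.
exact/is_derive_derive1/dg.
Qed.

Lemma diff_classM n J f g : open J ->
  diff_class n J f -> diff_class n J g -> diff_class n J (fun t => f t * g t).
Proof.
move=> oJ; elim: n f g => //= n IH f g [df cf] [dg cg]; split=> [t Jt|].
  exact: derivableM (df t Jt) (dg t Jt).
have cfw : diff_class n J f by apply: diff_classW; split.
have cgw : diff_class n J g by apply: diff_classW; split.
apply: eq_diff_class (diff_classD oJ (IH _ _ cfw cg) (IH _ _ cgw cf)) => //.
move=> t /[!inE] Jt.
apply/esym/is_derive_derive1E/is_derive_mulf.
  exact/is_derive_derive1/df.
exact/is_derive_derive1/dg.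
Qed.

Lemma diff_classN n J f : open J ->
  diff_class n J f -> diff_class n J (fun t => - f t).
Proof.
move=> oJ cf; apply: eq_diff_class (diff_classM oJ (diff_class_cst n J (-1)) cf).
  by [].
by move=> t _; rewrite mulN1r.
Qed.

(** Bootstrap: the derivative - f' / f^2 contains 1 / f only at the order already known. *)
Lemma diff_classV n J f : open J -> (forall t, J t -> f t != 0) ->
  diff_class n J f -> diff_class n J (fun t => (f t)^-1).
Proof.
move=> oJ f0; elim: n => // n IH cf; have cV := IH (diff_classW cf).
case: cf => df cf; split=> [t Jt|]; first exact: derivableV (f0 t Jt) (df t Jt).
apply: eq_diff_class (diff_classN oJ (diff_classM oJ (diff_classM oJ cV cV) cf)).
  by [].
move=> t /[!inE] Jt; apply/esym/is_derive_derive1E.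
apply: is_derive_eq; first exact/(is_derive_invf (f0 t Jt))/is_derive_derive1/df.
by rewrite -exprVn expr2 mulNr.
Qed.

Lemma smooth_on_cst J (a : R) : smooth_on J (fun _ => a).
Proof. by apply/smooth_onE => n; exact: diff_class_cst. Qed.

Lemma smooth_onD J f g : open J ->
  smooth_on J f -> smooth_on J g -> smooth_on J (fun t => f t + g t).
Proof.
move=> oJ /smooth_onE cf /smooth_onE cg; apply/smooth_onE => n.
exact: diff_classD.
Qed.

Lemma smooth_onN J f : open J -> smooth_on J f -> smooth_on J (fun t => - f t).
Proof. by move=> oJ /smooth_onE cf; apply/smooth_onE => n; exact: diff_classN. Qed.

Lemma smooth_onM J f g : open J ->
  smooth_on J f -> smooth_on J g -> smooth_on J (fun t => f t * g t).
Proof.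
move=> oJ /smooth_onE cf /smooth_onE cg; apply/smooth_onE => n.
exact: diff_classM.
Qed.

Lemma smooth_onV J f : open J -> (forall t, J t -> f t != 0) ->
  smooth_on J f -> smooth_on J (fun t => (f t)^-1).
Proof.
by move=> oJ f0 /smooth_onE cf; apply/smooth_onE => n; exact: diff_classV.
Qed.

(** The sign factor extends the root to negative numbers and gives 0 at 0, whatever [ln 0] is. *)
Definition cbrt (x : R) : R := Num.sg x * expR (ln `|x| / 3).

Lemma cbrtK x : cbrt x ^+ 3 = x.
Proof.
have [->|x0] := eqVneq x 0; first by rewrite /cbrt sgr0 mul0r expr0n.
rewrite /cbrt exprMn exprS sqr_sg x0 mulr1 -expRM_natl.
by rewrite (mulrC 3%:R) divfK ?pnatr_eq0 // lnK ?posrE ?normr_gt0 // -numEsg.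
Qed.

Lemma cbrt_eq0 x : (cbrt x == 0) = (x == 0).
Proof. by rewrite -[x in RHS]cbrtK expf_eq0. Qed.

Lemma expr3_inj : injective (fun x : R => x ^+ 3).
Proof.
move=> x y /= /eqP; rewrite -subr_eq0 subrXX mulf_eq0 subr_eq0 => /orP[/eqP //|].
rewrite !big_ord_recl big_ord0 /bump /= => /eqP h.
have h2 : x ^+ 2 + x * y + y ^+ 2 = 0 by rewrite -h; ring.
(* The quadratic factor is positive definite: 4 (x^2 + x y + y^2) = (2 x + y)^2 + 3 y^2. *)
have y0 : y = 0 by apply/eqP; rewrite -sqrf_eq0 eq_le sqr_ge0 andbT; nra.
by move: h2; rewrite y0 mulr0 expr0n !addr0 => /eqP; rewrite sqrf_eq0 => /eqP.
Qed.

Lemma cbrt_expr3 x : cbrt (x ^+ 3) = x.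
Proof. by apply: expr3_inj; rewrite /= cbrtK. Qed.

(** Derivative of an inverse function, for the cube at [cbrt x], where the slope 3 (cbrt x)^2 is not
    0. *)
Lemma is_derive_cbrt (x : R) : x != 0 -> is_derive x 1 cbrt (3 * cbrt x ^+ 2)^-1.
Proof.
move=> x0; rewrite -{1}[x]cbrtK.
apply: (@is_derive_inverse R (fun y : R => y ^+ 3) cbrt (3 * cbrt x ^+ 2)).
- by near=> y; exact: cbrt_expr3.
- by near=> y; exact: exprn_continuous.
- rewrite (_ : (fun y : R => y ^+ 3) = fun y => id y * (id y * id y)); last first.
    by apply/funext => y; rewrite !exprS expr0 mulr1.
  have id' := is_derive_id (cbrt x) (1 : R).
  apply: (is_derive_eq (is_derive_mulf id' (is_derive_mulf id' id'))).
  by rewrite /=; ring.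
- by rewrite mulf_neq0 ?pnatr_eq0 // expf_neq0 // cbrt_eq0.
Unshelve. all: by end_near. Qed.

Lemma is_derive_cbrtf f (t d : R) : f t != 0 -> is_derive t 1 f d ->
  is_derive t 1 (fun s => cbrt (f s)) ((3 * cbrt (f t) ^+ 2)^-1 * d).
Proof. by move=> /is_derive_cbrt dc df; exact: (@is_derive1_comp _ cbrt f). Qed.

(** Bootstrap again: the derivative f' / (3 cbrt(f)^2) contains cbrt(f) only at the order already
    known. *)
Lemma smooth_on_cbrt J f : open J -> (forall t, J t -> f t != 0) ->
  smooth_on J f -> smooth_on J (fun t => cbrt (f t)).
Proof.
move=> oJ f0 /smooth_onE cf; apply/smooth_onE => n.
have {}cf := cf n; elim: n cf => // n IH cf; have cc := IH (diff_classW cf).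
case: cf => df cf; split=> [t Jt|].
  exact: is_derive_derivable (is_derive_cbrtf (f0 t Jt) (is_derive_derive1 (df t Jt))).
have cV : diff_class n J (fun t => (3 * (cbrt (f t) * cbrt (f t)))^-1).
  apply: diff_classV => //.
    by move=> t Jt; rewrite mulf_neq0 ?pnatr_eq0 // mulf_neq0 // cbrt_eq0 f0.
  by apply: diff_classM => //; [exact: diff_class_cst | exact: diff_classM].
apply: eq_diff_class (diff_classM oJ cV cf) => // t /[!inE] Jt.
rewrite -expr2; apply/esym/is_derive_derive1E/(is_derive_cbrtf (f0 t Jt)).
exact/is_derive_derive1/df.
Qed.

End Calculus.

(** * Explicit determinants and the Levi-Civita symbol *)

Section Det.
Context {R : comNzRingType}.

(** Entries are indexed by [nat], so that they reduce at concrete indices and [ring] can finish. *)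
Lemma det3 (f : nat -> nat -> R) : \det (\matrix_(a < 3, b < 3) f a b) =
    f 0 0 * (f 1 1 * f 2 2 - f 1 2 * f 2 1)
  - f 0 1 * (f 1 0 * f 2 2 - f 1 2 * f 2 0)
  + f 0 2 * (f 1 0 * f 2 1 - f 1 1 * f 2 0).
Proof.
rewrite (expand_det_row _ ord0) !big_ord_recl big_ord0 /cofactor.
rewrite !(expand_det_row _ ord0) !big_ord_recl !big_ord0 /cofactor !det_mx11 !mxE /=.
rewrite /bump /=; ring.
Qed.

Definition minor4 (f : nat -> nat -> R) (j k l : nat) : R :=
    f 1 j * (f 2 k * f 3 l - f 2 l * f 3 k)
  - f 1 k * (f 2 j * f 3 l - f 2 l * f 3 j)
  + f 1 l * (f 2 j * f 3 k - f 2 k * f 3 j).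

Lemma det4 (f : nat -> nat -> R) : \det (\matrix_(a < 2 + 2, b < 2 + 2) f a b) =
    f 0 0 * minor4 f 1 2 3 - f 0 1 * minor4 f 0 2 3
  + f 0 2 * minor4 f 0 1 3 - f 0 3 * minor4 f 0 1 2.
Proof.
rewrite (expand_det_row _ ord0) !big_ord_recl big_ord0 /cofactor.
pose g j a b := f (bump 0 a) (bump j b).
have E j : row' ord0 (col' j (\matrix_(a < 4, b < 4) f a b)) = \matrix_(a < 3, b < 3) g j a b.
  by apply/matrixP => a b; rewrite !mxE.
rewrite !E !det3 /g /minor4 !mxE /bump /=; ring.
Qed.
End Det.

Section Levi.
Context {R : realType}.

Definition sign4 (k l i j : nat) : int :=
  let f a b := ((nth 0%N [:: k; l; i; j] a == b)%:R : int) in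
  f 0 0 * minor4 f 1 2 3 - f 0 1 * minor4 f 0 2 3
  + f 0 2 * minor4 f 0 1 3 - f 0 3 * minor4 f 0 1 2.

Lemma levi_civita4 (k l i j : 'I_(2 + 2)) :
  levi_civita R (tnth [tuple k; l; i; j]) = (sign4 k l i j)%:~R.
Proof.
rewrite /sign4 -(det4 (fun a b => (nth 0%N [:: k : nat; l : nat; i : nat; j : nat] a == b)%:R)).
rewrite /levi_civita -det_map_mx; congr (\det _); apply/matrixP => a b; rewrite !mxE.
rewrite (tnth_nth 0) /=.
have -> : (nth 0 [:: k; l; i; j] a == b) =
    (nth 0%N [:: k : nat; l : nat; i : nat; j : nat] a == b).
  by case: a => [[|[|[|[|//]]]] ?].
by case: (_ == _).
Qed.

(** For given i and j only the two orderings of the complementary pair contribute; each [s k l] is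
    written so that (k, l, i, j) is an even permutation. *)
Lemma starE (S : 'M[R]_(2 + 2)) (i j : 'I_(2 + 2)) :
  \sum_k \sum_l S k l * levi_civita R (tnth [tuple k; l; i; j]) =
  let s k l := S (inord k) (inord l) - S (inord l) (inord k) in
  (match val i, val j with
  | 0%N, 1%N => s 2 3 | 0%N, 2%N => s 3 1 | 0%N, 3%N => s 1 2
  | 1%N, 0%N => s 3 2 | 1%N, 2%N => s 0 3 | 1%N, 3%N => s 2 0
  | 2%N, 0%N => s 1 3 | 2%N, 1%N => s 3 0 | 2%N, 3%N => s 0 1
  | 3%N, 0%N => s 2 1 | 3%N, 1%N => s 0 2 | 3%N, 2%N => s 1 0
  | _, _ => 0
  end).
Proof.
pose T (a b : nat) := S (inord a) (inord b).
have TE k l : S k l = T k l by rewrite /T !inord_val.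
under eq_bigr do under eq_bigr do rewrite TE levi_civita4.
rewrite !big_ord_recl !big_ord0 /= /bump /= !addn0 !add1n.
by case: i => [[|[|[|[|//]]]] ?]; case: j => [[|[|[|[|//]]]] ?];
  rewrite -/(T _ _) /= -?/(T _ _) /sign4 /minor4 /=; ring.
Qed.
End Levi.

(** * Homogeneous and affine coordinates, and the cross product in them *)

Section Affine.
Context {R : realType}.
Implicit Types (z v w : 'rV[R]_(2 + 2)) (s t a b c d : R).

Definition sign3 (i j k : nat) : int :=
  let f (a b : nat) := ((nth 0%N [:: i; j; k] a == b)%:R : int) in
    f 0 0 * (f 1 1 * f 2 2 - f 1 2 * f 2 1)
  - f 0 1 * (f 1 0 * f 2 2 - f 1 2 * f 2 0)
  + f 0 2 * (f 1 0 * f 2 1 - f 1 1 * f 2 0).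

Lemma levi_civita3 (i j k : 'I_3) :
  levi_civita R (tnth [tuple i; j; k]) = (sign3 i j k)%:~R.
Proof.
rewrite /sign3 -(det3 (fun a b : nat => (nth 0%N [:: i : nat; j : nat; k : nat] a == b)%:R)).
rewrite /levi_civita -det_map_mx; congr (\det _); apply/matrixP => a b; rewrite !mxE.
rewrite (tnth_nth ord0) /=.
have -> : (nth ord0 [:: i; j; k] a == b) = (nth 0%N [:: i : nat; j : nat; k : nat] a == b).
  by case: a => [[|[|[|//]]] ?].
by case: (_ == _).
Qed.

Definition col3 (s : seq R) : 'cV[R]_3 := \col_k nth 0 s k.
Definition row3 (s : seq R) : 'rV[R]_3 := \row_k nth 0 s k.

Lemma cross_col3 a b c a' b' c' : cross (col3 [:: a; b; c]) (col3 [:: a'; b'; c']) =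
  row3 [:: b * c' - c * b'; c * a' - a * c'; a * b' - b * a'].
Proof.
apply/rowP => i; rewrite !mxE.
under eq_bigr do under eq_bigr do rewrite levi_civita3 !mxE.
rewrite !big_ord_recl !big_ord0 /= /bump /=.
case: i => [[|[|[|//]]] ?]; rewrite /sign3 /=; ring.
Qed.

Lemma pairing_row3 a b c a' b' c' :
  pairing (row3 [:: a; b; c]) (col3 [:: a'; b'; c']) = a * a' + b * b' + c * c'.
Proof.
by rewrite /pairing !mxE !big_ord_recl big_ord0 !mxE /= addr0 addrA.
Qed.

(* The homogeneous coordinates [s; a; b], with s put in position i. *)
Definition ins (i : 'I_3) s a b : seq R :=
  match val i with 0%N => [:: s; a; b] | 1%N => [:: a; s; b] | _ => [:: a; b; s] end.

Lemma homogE i (x : 'rV[R]_2) : homog i x = row3 (ins i 1 (x 0 0) (x 0 1)).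
Proof.
apply/rowP => k; rewrite !mxE; case: unliftP => [l ->|->]; last first.
  by case: i => [[|[|[|//]]] ?].
have xE (m : 'I_2) (m' : 'I_2) : val m = val m' -> x 0 m = x 0 m'.
  by move=> mm; congr (x 0 _); apply: val_inj.
by case: i => [[|[|[|//]]] ?]; case: l => [[|[|//]] ?]; exact: xE.
Qed.

Lemma pairing_ins i s a b t c d :
  pairing (row3 (ins i s a b)) (col3 (ins i t c d)) = s * t + a * c + b * d.
Proof. by case: i => [[|[|[|//]]] ?]; rewrite /ins pairing_row3; ring. Qed.

(** Sign of the permutation moving the i-th coordinate to the front: the cross product picks it up
    when the three charts are written in the same coordinates. *)
Definition chart_sign (i : 'I_3) : R := (-1) ^+ i.

Lemma cross_ins i s a b t c d :
  cross (col3 (ins i s a b)) (col3 (ins i t c d)) =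
  chart_sign i *: row3 (ins i (a * d - b * c) (t * b - s * d) (s * c - t * a)).
Proof.
apply/rowP => k; rewrite /chart_sign.
by case: i => [[|[|[|//]]] ?]; rewrite /ins cross_col3 !mxE;
   case: k => [[|[|[|//]]] ?] /=; ring.
Qed.

Lemma row3_inj a b c a' b' c' : row3 [:: a; b; c] = row3 [:: a'; b'; c'] ->
  [/\ a = a', b = b' & c = c'].
Proof.
move=> /rowP e.
have e0 := e (inord 0); have e1 := e (inord 1); have e2 := e (inord 2).
by move: e0 e1 e2; rewrite !mxE !inordK.
Qed.

Lemma row3_ins_inj i s a b t c d : row3 (ins i s a b) = row3 (ins i t c d) ->
  [/\ s = t, a = c & b = d].
Proof. by case: i => [[|[|[|//]]] ?] /row3_inj[]. Qed.

Lemma tr_row3 (s : seq R) : (row3 s)^T = col3 s.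
Proof. by apply/colP => k; rewrite !mxE. Qed.

Lemma scale_row3_ins k i s a b :
  k *: row3 (ins i s a b) = row3 (ins i (k * s) (k * a) (k * b)).
Proof.
apply/rowP => j.
by case: i => [[|[|[|//]]] ?]; rewrite !mxE; case: j => [[|[|[|//]]] ?].
Qed.

Lemma scale_col3_ins k i s a b :
  k *: col3 (ins i s a b) = col3 (ins i (k * s) (k * a) (k * b)).
Proof. by rewrite -!tr_row3 -linearZ scale_row3_ins. Qed.

(* Indexed by nat, so that coordinates compute after a case analysis on ordinals. *)
Definition co z (n : nat) : R := z 0 (inord n).

Lemma coE z k : z 0 k = co z k.
Proof. by rewrite /co inord_val. Qed.

Definition vec4 (x0 x1 y0 y1 : R) : 'rV[R]_(2 + 2) :=
  \row_k nth 0 [:: x0; x1; y0; y1] k.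

Lemma co_vec4 x0 x1 y0 y1 n : (n < 4)%N ->
  co (vec4 x0 x1 y0 y1) n = nth 0 [:: x0; x1; y0; y1] n.
Proof. by move=> n4; rewrite /co mxE inordK. Qed.

Lemma vec4_co z : z = vec4 (co z 0) (co z 1) (co z 2) (co z 3).
Proof.
by apply/rowP => k; rewrite !mxE coE; case: k => [[|[|[|[|//]]]] ?].
Qed.

Lemma coP z w : [/\ co z 0 = co w 0, co z 1 = co w 1, co z 2 = co w 2 &
  co z 3 = co w 3] -> z = w.
Proof. by case=> e0 e1 e2 e3; rewrite (vec4_co z) e0 e1 e2 e3 -vec4_co. Qed.

(* The pairing p q of the affine representatives; it is the same polynomial in all three charts. *)
Definition rho z : R := 1 + co z 0 * co z 2 + co z 1 * co z 3.

Lemma chart_qE i z : chart_q i z = col3 (ins i 1 (co z 0) (co z 1)).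
Proof. by rewrite /chart_q homogE tr_row3 !mxE !coE. Qed.

Lemma chart_pE i z : chart_p i z = row3 (ins i 1 (co z 2) (co z 3)).
Proof. by rewrite /chart_p homogE !mxE !coE. Qed.

Lemma rhoE i z : pairing (chart_p i z) (chart_q i z) = rho z.
Proof. by rewrite chart_pE chart_qE pairing_ins /rho; ring. Qed.

Lemma is_derive_mx (V : normedModType R) m n (M : V -> 'M[R]_(m, n)) (x u : V)
    (dM : 'M[R]_(m, n)) i j :
  is_derive x u M dM -> is_derive x u (fun y => M y i j) (dM i j).
Proof.
move=> [d <-]; apply: DeriveDef; first exact/(iffLR (derivable_mxP _ _ _)).
by rewrite derive_mx // mxE.
Qed.

Lemma is_derive_mxP (V : normedModType R) m n (M : V -> 'M[R]_(m, n)) (x u : V)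
    (dM : 'M[R]_(m, n)) :
  (forall i j, is_derive x u (fun y => M y i j) (dM i j)) -> is_derive x u M dM.
Proof.
move=> d; have dM' : derivable M x u.
  by apply/derivable_mxP => i j; exact: is_derive_derivable (d i j).
apply: DeriveDef => //; rewrite derive_mx //; apply/matrixP => i j.
by rewrite mxE; have [_ ->] := d i j.
Qed.

Lemma is_derive_co z v n : is_derive z v (fun y => co y n) (co v n).
Proof. exact: (@is_derive_mx _ _ _ id z v _ 0 (inord n) (is_derive_id z v)). Qed.

Lemma is_derive_row3_ins i (V : normedModType R) (s a b : V -> R) (x u : V) ds da db :
  is_derive x u s ds -> is_derive x u a da -> is_derive x u b db ->
  is_derive x u (fun y => row3 (ins i (s y) (a y) (b y))) (row3 (ins i ds da db)).
Proof.
move=> hs ha hb; apply: is_derive_mxP => j k; rewrite mxE.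
under [X in is_derive _ _ X]eq_fun do rewrite mxE.
by case: i => [[|[|[|//]]] ?]; case: k => [[|[|[|//]]] ?].
Qed.

Lemma is_derive_col3_ins i (V : normedModType R) (s a b : V -> R) (x u : V) ds da db :
  is_derive x u s ds -> is_derive x u a da -> is_derive x u b db ->
  is_derive x u (fun y => col3 (ins i (s y) (a y) (b y))) (col3 (ins i ds da db)).
Proof.
move=> hs ha hb; apply: is_derive_mxP => k j; rewrite mxE.
under [X in is_derive _ _ X]eq_fun do rewrite mxE.
by case: i => [[|[|[|//]]] ?]; case: k => [[|[|[|//]]] ?].
Qed.

End Affine.

(** * The dancing metric in affine coordinates *)

Section Metric.
Context {R : realType}.
Implicit Types (z v w : 'rV[R]_(2 + 2)) (s t a b c d : R).

Definition drho z v : R :=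
  co z 0 * co v 2 + co z 2 * co v 0 + co z 1 * co v 3 + co z 3 * co v 1.

Lemma is_derive_rho z v : is_derive z v (@rho R) (drho z v).
Proof.
have c n := is_derive_co z v n.
apply: (is_derive_eq (is_derive_addf (is_derive_addf (is_derive_cst (1 : R) z v)
  (is_derive_mulf (c 0) (c 2))) (is_derive_mulf (c 1) (c 3)))).
by rewrite /drho; ring.
Qed.

Lemma dsectionE i z v : rho z != 0 -> dsection i z v =
  (col3 (ins i 0 (co v 0) (co v 1)),
   row3 (ins i (- (rho z) ^- 2 * drho z v)
      ((rho z)^-1 * co v 2 + co z 2 * (- (rho z) ^- 2 * drho z v))
      ((rho z)^-1 * co v 3 + co z 3 * (- (rho z) ^- 2 * drho z v)))).
Proof.
move=> rz; have c n := is_derive_co z v n.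
have dr := is_derive_invf rz (is_derive_rho z v).
congr (_, _).
  have -> : fst \o local_section i =
      fun y : 'rV[R]_(2 + 2) => col3 (ins i (cst 1 y) (co y 0) (co y 1)).
    by apply/funext => y; rewrite /= chart_qE.
  by have [_ ->] := is_derive_col3_ins i (is_derive_cst (1 : R) z v) (c 0) (c 1).
have -> : snd \o local_section i = fun y : 'rV[R]_(2 + 2) =>
    row3 (ins i (rho y)^-1 ((rho y)^-1 * co y 2) ((rho y)^-1 * co y 3)).
  by apply/funext => y; rewrite /= rhoE chart_pE scale_row3_ins mulr1.
by have [_ ->] := is_derive_row3_ins i dr (is_derive_mulf dr (c 2)) (is_derive_mulf dr (c 3)).
Qed.

Lemma pairingDl (p1 p2 : 'rV[R]_3) q : pairing (p1 + p2) q = pairing p1 q + pairing p2 q.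
Proof. by rewrite /pairing mulmxDl mxE. Qed.

Lemma pairingDr p (q1 q2 : 'cV[R]_3) : pairing p (q1 + q2) = pairing p q1 + pairing p q2.
Proof. by rewrite /pairing mulmxDr mxE. Qed.

Lemma pairingZl k (p : 'rV[R]_3) q : pairing (k *: p) q = k * pairing p q.
Proof. by rewrite /pairing -scalemxAl mxE. Qed.

Lemma pairingZr k p (q : 'cV[R]_3) : pairing p (k *: q) = k * pairing p q.
Proof. by rewrite /pairing -scalemxAr mxE. Qed.

Lemma pairingNl (p : 'rV[R]_3) q : pairing (- p) q = - pairing p q.
Proof. by rewrite /pairing mulNmx mxE. Qed.

Lemma flat_horizontal (Q u w : ambient R) : flat (vertical Q) (vertical Q) != 0 ->
  flat (horizontal Q u) (horizontal Q w) =
  flat u w - flat u (vertical Q) * flat w (vertical Q) / flat (vertical Q) (vertical Q).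
Proof.
move=> V0; rewrite /horizontal; move: (vertical Q) V0 => V V0.
have flatC (a b : ambient R) : flat a b = flat b a by rewrite /flat addrC.
have flatB (a b : ambient R) k (c : ambient R) : flat (a - k *: b) c = flat a c - k * flat b c.
  rewrite /flat /= -scaleNr pairingDl pairingZl -scaleNr pairingDr pairingZr; ring.
rewrite flatB (flatC u) (flatC V (_ - _)) !flatB (flatC w u) (flatC V u).
by move: (flat V V) (flat u V) (flat w V) (flat u w) V0 => ? ? ? ? V0; field.
Qed.

(* The nonzero entries are the mixed second derivatives of - ln rho: a para-Kähler metric. *)
Definition metric_coef z (a b : nat) : R :=
  match a, b with
  | 0%N, 2%N | 2%N, 0%N => - (1 + co z 1 * co z 3) / (rho z) ^+ 2
  | 1%N, 3%N | 3%N, 1%N => - (1 + co z 0 * co z 2) / (rho z) ^+ 2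
  | 0%N, 3%N | 3%N, 0%N => co z 1 * co z 2 / (rho z) ^+ 2
  | 1%N, 2%N | 2%N, 1%N => co z 0 * co z 3 / (rho z) ^+ 2
  | _, _ => 0
  end.

Definition metric z : 'M[R]_(2 + 2) := \matrix_(a, b) metric_coef z a b.

Lemma co_delta (a : 'I_(2 + 2)) n : (n < 4)%N ->
  co (delta_mx 0 a : 'rV[R]_(2 + 2)) n = (n == a)%:R.
Proof.
move=> n4; rewrite /co mxE eqxx /=; congr ((_ : bool)%:R).
by rewrite -val_eqE /= inordK.
Qed.

Lemma dancing_metricE i z : rho z != 0 -> dancing_metric i z = metric z.
Proof.
move=> rz; apply/matrixP => a b; rewrite !mxE.
have VE : vertical (local_section i z) =
    (col3 (ins i 1 (co z 0) (co z 1)),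
     - row3 (ins i (rho z)^-1 ((rho z)^-1 * co z 2) ((rho z)^-1 * co z 3))).
  by rewrite /vertical /= rhoE chart_qE chart_pE scale_row3_ins mulr1.
have flatVV : flat (vertical (local_section i z)) (vertical (local_section i z)) = 2.
  rewrite VE /flat /= pairingNl pairing_ins.
  by move: rz; rewrite /rho => rz; field.
rewrite flat_horizontal flatVV ?pnatr_eq0 // !dsectionE // VE /flat /=.
rewrite !pairingNl !pairing_ins /drho !co_delta //.
move: rz; rewrite /metric_coef /rho => rz.
by case: a => [[|[|[|[|//]]]] ?]; case: b => [[|[|[|[|//]]]] ?]; rewrite /=; field.
Qed.

(** Let H be minus the mixed block of the metric times rho^2. Its determinant is rho, so inverting
    the block - H / rho^2 gives - rho adj(H), which is polynomial. *)
Definition inv_metric_coef z (a b : nat) : R :=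
  match a, b with
  | 0%N, 2%N | 2%N, 0%N => - (1 + co z 0 * co z 2) * rho z
  | 1%N, 3%N | 3%N, 1%N => - (1 + co z 1 * co z 3) * rho z
  | 0%N, 3%N | 3%N, 0%N => - (co z 0 * co z 3) * rho z
  | 1%N, 2%N | 2%N, 1%N => - (co z 1 * co z 2) * rho z
  | _, _ => 0
  end.

Lemma mul_metric_inv z : rho z != 0 ->
  metric z *m (\matrix_(a, b) inv_metric_coef z a b) = 1%:M.
Proof.
move=> rz; apply/matrixP => a b; rewrite !mxE.
under eq_bigr do rewrite !mxE.
rewrite !big_ord_recl big_ord0 -val_eqE /=.
move: rz; rewrite /metric_coef /inv_metric_coef /rho => rz.
by case: a => [[|[|[|[|//]]]] ?]; case: b => [[|[|[|[|//]]]] ?]; rewrite /= /bump /=; field.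
Qed.

Lemma invmx_metric z : rho z != 0 ->
  invmx (metric z) = \matrix_(a, b) inv_metric_coef z a b.
Proof.
move=> /mul_metric_inv h; have [u _] := mulmx1_unit h.
by rewrite -[LHS]mulmx1 -h mulKmx.
Qed.

End Metric.

(** * Orientation, volume and the Hodge star *)

Section SelfDual.
Context {R : realType}.
Implicit Types (z v w : 'rV[R]_(2 + 2)) (s t a b c d k : R).

Lemma inner_metric z v w : inner (metric z) v w =
  - ((co v 0 * co w 2 + co w 0 * co v 2) * (1 + co z 1 * co z 3)
   + (co v 1 * co w 3 + co w 1 * co v 3) * (1 + co z 0 * co z 2)
   - (co v 0 * co w 3 + co w 0 * co v 3) * (co z 1 * co z 2)
   - (co v 1 * co w 2 + co w 1 * co v 2) * (co z 0 * co z 3)) / (rho z) ^+ 2.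
Proof.
rewrite /inner !mxE.
under eq_bigr do rewrite !mxE.
under eq_bigr do under eq_bigr do rewrite !mxE !coE.
rewrite !big_ord_recl !big_ord0 /= /bump /= !addn0 !add1n !coE /= /bump /= !addn0 !add1n.
rewrite /metric_coef; ring.
Qed.

(** The determinant is the square of that of the mixed block, rho / rho^4; kept as a square, it has
    an immediate square root. *)
Lemma det_metric z : rho z != 0 -> \det (metric z) = ((rho z) ^- 3) ^+ 2.
Proof.
by move=> rz; rewrite det4 /minor4 /metric_coef /=; move: rz; rewrite /rho => rz; field.
Qed.

(** With X and Y the 2 x 2 matrices of x-parts and y-parts, subtracting the rows (X, Y) from (X, -
    Y) leaves det X det(- 2 Y). *)
Lemma det_paraK v1 v2 :
  \det (col_mx (col_mx v1 v2) (col_mx (paraK v1) (paraK v2)) : 'M[R]_(2 + 2)) =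
  4 * (co v1 0 * co v2 1 - co v1 1 * co v2 0) * (co v1 2 * co v2 3 - co v1 3 * co v2 2).
Proof.
pose f (a b : nat) := match a with
  | 0%N => co v1 b | 1%N => co v2 b
  | 2%N => if (b < 2)%N then co v1 b else - co v1 b
  | _ => if (b < 2)%N then co v2 b else - co v2 b end.
rewrite (_ : col_mx _ _ = \matrix_(a < 2 + 2, b < 2 + 2) f a b).
  by rewrite det4 /minor4 /f /=; ring.
have KE (v : 'rV[R]_(2 + 2)) (b : 'I_(2 + 2)) :
    paraK v 0 b = if (b < 2)%N then co v b else - co v b.
  rewrite mxE; case: splitP => j bE; rewrite !mxE coE /= bE ?ltn_ord //.
apply/matrixP => a b; rewrite !mxE.
case: splitP => i aE; rewrite mxE; case: splitP => j iE; rewrite ord1.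
- by rewrite aE iE ord1 coE.
- by rewrite aE iE ord1 coE.
- by rewrite aE iE ord1 KE.
- by rewrite aE iE ord1 KE.
Qed.

(** [positively_oriented] only asserts that some frame exists, so [orient] must treat all
    orthonormal frames at once before the value -1 can be justified. *)
Lemma orientation_signE z : rho z != 0 -> orientation_sign (metric z) = Num.sg (rho z).
Proof.
move=> rz.
have orient v1 v2 : inner (metric z) v1 v1 = 1 -> inner (metric z) v2 v2 = 1 ->
    inner (metric z) v1 v2 = 0 ->
    (0 < \det (1%:M : 'M[R]_(2 + 2)) *
      \det (col_mx (col_mx v1 v2) (col_mx (paraK v1) (paraK v2)) : 'M[R]_(2 + 2))) =
    (0 < rho z).
  rewrite det1 mul1r det_paraK !inner_metric => h11 h22 h12.
  set D := 4 * _ * _.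
  (* With H = - (off-diagonal block of the metric), h11, h22 and h12 say that the symmetric
     part of (x_i H y_j^T) is - 1/2, so its determinant is 1/4 plus a square. *)
  pose m := (co v1 0 * co v2 2 - co v2 0 * co v1 2) * (1 + co z 1 * co z 3)
   + (co v1 1 * co v2 3 - co v2 1 * co v1 3) * (1 + co z 0 * co z 2)
   - (co v1 0 * co v2 3 - co v2 0 * co v1 3) * (co z 1 * co z 2)
   - (co v1 1 * co v2 2 - co v2 1 * co v1 2) * (co z 0 * co z 3).
  have E : D * rho z = (1 + (m / rho z ^+ 2) ^+ 2) * (rho z ^+ 2) ^+ 2.
    set u11 := (X in X = 1) in h11; set u22 := (X in X = 1) in h22.
    set u12 := (X in X = 0) in h12.
    transitivity ((u11 * u22 - u12 ^+ 2 + (m / rho z ^+ 2) ^+ 2) * (rho z ^+ 2) ^+ 2); last first.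
      by rewrite h11 h22 h12; ring.
    by rewrite /u11 /u22 /u12 /D /m; move: rz; rewrite /rho => rz; field.
  have D0 : 0 < D * rho z.
    rewrite E mulr_gt0 ?exprn_even_gt0 ?expf_neq0 //.
    by rewrite ltr_pwDl // sqr_ge0.
  apply/idP/idP => h; first by rewrite -(pmulr_rgt0 _ h).
  by rewrite -(pmulr_lgt0 _ h).
rewrite /orientation_sign; case: asboolP => [[v1 [v2 [h11 h22 h12]]]|no].
  by rewrite orient // => /gtr0_sg ->.
rewrite ltr0_sg // lt_neqAle rz /= leNgt; apply/negP => r0; apply: no.
(* For rho > 0 a frame has to be exhibited. Its x-parts are the standard basis and its y-parts are
   half the columns of the inverse mixed block, which makes it orthonormal. *)
pose r := rho z.
exists (vec4 1 0 (- r / 2 * (1 + co z 0 * co z 2)) (- r / 2 * (co z 0 * co z 3))).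
exists (vec4 0 1 (- r / 2 * (co z 1 * co z 2)) (- r / 2 * (1 + co z 1 * co z 3))).
set v1 := vec4 _ _ _ _; set v2 := vec4 _ _ _ _.
have i11 : inner (metric z) v1 v1 = 1.
  by rewrite inner_metric !co_vec4 //= /r; move: rz; rewrite /rho => rz; field.
have i22 : inner (metric z) v2 v2 = 1.
  by rewrite inner_metric !co_vec4 //= /r; move: rz; rewrite /rho => rz; field.
have i12 : inner (metric z) v1 v2 = 0.
  by rewrite inner_metric !co_vec4 //= /r; move: rz; rewrite /rho => rz; field.
by split=> //; rewrite orient.
Qed.

(** The square root leaves |rho|^-3, and the orientation sign, that of rho, removes the absolute
    value. *)
Lemma volume_coef z : rho z != 0 ->
  orientation_sign (metric z) * (Num.sqrt `|\det (metric z)| / 2) = (rho z) ^- 3 / 2.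
Proof.
move=> rz; rewrite orientation_signE // det_metric // normrX real_normK ?num_real //.
rewrite sqrtr_sqr mulrA; congr (_ / _).
rewrite normfV normrX -[in RHS](mulr_sg_norm (rho z)).
have n0 : `|rho z| != 0 by rewrite normr_eq0.
have [r0|r0|r0] := ltgtP (rho z) 0; last by rewrite r0 eqxx in rz.
  by rewrite (ltr0_sg r0); move: `|rho z| n0 => n n0; field.
by rewrite (gtr0_sg r0) !mul1r.
Qed.

Definition raise z (th : 'cV[R]_(2 + 2)) (a : nat) : R :=
  \sum_(b < 2 + 2) inv_metric_coef z a b * th b 0.

(** Raising both indices of a decomposable form gives the wedge of the two raised covectors, so only
    their 2 x 2 minors occur. *)
Lemma hodge_wedge z (th1 th2 : 'cV[R]_(2 + 2)) (i j : 'I_(2 + 2)) : rho z != 0 ->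
  hodge (metric z) (wedge th1 th2) i j =
  let s (k l : nat) := raise z th1 k * raise z th2 l - raise z th2 k * raise z th1 l in
  (rho z) ^- 3 * (match val i, val j with
  | 0%N, 1%N => s 2 3 | 0%N, 2%N => s 3 1 | 0%N, 3%N => s 1 2
  | 1%N, 0%N => s 3 2 | 1%N, 2%N => s 0 3 | 1%N, 3%N => s 2 0
  | 2%N, 0%N => s 1 3 | 2%N, 1%N => s 3 0 | 2%N, 3%N => s 0 1
  | 3%N, 0%N => s 2 1 | 3%N, 1%N => s 0 2 | 3%N, 2%N => s 1 0
  | _, _ => 0
  end).
Proof.
move=> rz; rewrite mxE volume_coef // starE.
set S := _ *m _ *m _.
have SE (k l : nat) : (k < 4)%N -> (l < 4)%N -> S (inord k) (inord l) =
    raise z th1 k * raise z th2 l - raise z th2 k * raise z th1 l.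
  move=> k4 l4; rewrite /S invmx_metric // /wedge mulmxBr mulmxBl.
  set I := \matrix_(a, b) _.
  have IE (th : 'cV[R]_(2 + 2)) (m : nat) : (m < 4)%N -> (I *m th) (inord m) 0 = raise z th m.
    by move=> m4; rewrite mxE; apply: eq_bigr => b _; rewrite mxE inordK.
  have PE u1 u2 : (I *m (u1 *m u2^T) *m I^T) (inord k) (inord l) = raise z u1 k * raise z u2 l.
    by rewrite !mulmxA -mulmxA -trmx_mul mxE big_ord1 [_^T _ _]mxE !IE.
  by rewrite !mxE -/I; move: (PE th1 th2) (PE th2 th1); rewrite !mxE => -> ->.
by case: i => [[|[|[|[|//]]]] ?]; case: j => [[|[|[|[|//]]]] ?]; rewrite /= ?SE //; field.
Qed.

End SelfDual.

(** * Self-dual null planes as graphs *)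

Section Graph.
Context {R : realType}.
Implicit Types (z v w : 'rV[R]_(2 + 2)) (k : R) (th : 'cV[R]_(2 + 2)).

(* With z = (x, y), q = (x, 1) and v = (x', y'), the covector q * x' (cross product) is
   (- x'_1, x'_0, - area); subtracting a multiple of p = (y, 1) to kill its last entry
   leaves (turn0, turn1). So the graphs y' = k (turn0, turn1) below are the planes
   p' = k q * q' modulo p. *)
Definition area z v : R := co z 1 * co v 0 - co z 0 * co v 1.
Definition turn0 z v : R := - co v 1 + co z 2 * area z v.
Definition turn1 z v : R := co v 0 + co z 3 * area z v.

Definition in_graph z k w : Prop :=
  co w 2 = k * turn0 z w /\ co w 3 = k * turn1 z w.

Definition graph_vec z k (a b : R) : 'rV[R]_(2 + 2) :=
  vec4 a b (k * turn0 z (vec4 a b 0 0)) (k * turn1 z (vec4 a b 0 0)).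

Definition graph_plane z k : {vspace 'rV[R]_(2 + 2)} :=
  <<[:: graph_vec z k 1 0; graph_vec z k 0 1]>>%VS.

Lemma coD v w n : co (v + w) n = co v n + co w n.
Proof. by rewrite /co mxE. Qed.

Lemma coZ k v n : co (k *: v) n = k * co v n.
Proof. by rewrite /co mxE. Qed.

(** The linear map from x' to ([turn0], [turn1]) has determinant rho; the two identities are
    Cramer's rule. *)
Lemma turn_eq0 z v : rho z != 0 -> turn0 z v = 0 -> turn1 z v = 0 ->
  co v 0 = 0 /\ co v 1 = 0.
Proof.
move=> rz; rewrite /turn0 /turn1 /area => r0 r1.
have E0 : rho z * co v 0 = 0.
  transitivity ((1 + co z 0 * co z 2) * (co v 0 + co z 3 * (co z 1 * co v 0 - co z 0 * co v 1))
    - co z 0 * co z 3 * (- co v 1 + co z 2 * (co z 1 * co v 0 - co z 0 * co v 1))).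
    by rewrite /rho; ring.
  by rewrite r0 r1 !mulr0 subr0.
have E1 : rho z * co v 1 = 0.
  transitivity (co z 1 * co z 2 * (co v 0 + co z 3 * (co z 1 * co v 0 - co z 0 * co v 1))
    - (1 + co z 1 * co z 3) * (- co v 1 + co z 2 * (co z 1 * co v 0 - co z 0 * co v 1))).
    by rewrite /rho; ring.
  by rewrite r0 r1 !mulr0 subr0.
by split; apply/eqP; [move/eqP: E0 | move/eqP: E1]; rewrite mulf_eq0 (negPf rz).
Qed.

Lemma mem_graph_plane z k w : w \in graph_plane z k <-> in_graph z k w.
Proof.
rewrite /graph_plane span_cons span_seq1; split=> [|[w2 w3]].
  case/memv_addP => u /vlineP[c ->] [u' /vlineP[d ->] ->].
  rewrite /in_graph /turn0 /turn1 /area !coD !coZ !co_vec4 //=.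
  by rewrite /turn0 /turn1 /area !co_vec4 //=; split; ring.
apply/memv_addP; exists (co w 0 *: graph_vec z k 1 0); first exact/memvZ/memv_line.
exists (co w 1 *: graph_vec z k 0 1); first exact/memvZ/memv_line.
apply: coP; rewrite !coD !coZ !co_vec4 //= w2 w3 /turn0 /turn1 /area !co_vec4 //=.
by split; ring.
Qed.

(** With H minus the mixed block times rho^2, H sends ([turn0], [turn1]) to rho (- x'_1, x'_0).
    Pairing the x-part of one graph vector with the y-part of another is thus skew, and the metric
    symmetrises it to 0. *)
Lemma null_graph_plane z k : rho z != 0 -> null_plane (metric z) (graph_plane z k).
Proof.
move=> rz; split.
  have fr : free [:: graph_vec z k 1 0; graph_vec z k 0 1].
    rewrite free_cons span_seq1 seq1_free; apply/andP; split.
      apply/negP => /vlineP[c] /(congr1 (co^~ 0%N)) /=.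
      by rewrite coZ !co_vec4 //= mulr0 => /eqP; rewrite oner_eq0.
    apply/eqP => /(congr1 (co^~ 1%N)) /=.
    by rewrite !co_vec4 //= /co mxE => /eqP; rewrite oner_eq0.
  exact/eqP.
move=> v w /mem_graph_plane[v2 v3] /mem_graph_plane[w2 w3].
rewrite inner_metric v2 v3 w2 w3 /turn0 /turn1 /area.
by move: rz; rewrite /rho => rz; field.
Qed.

Definition col4 (a b c d : R) : 'cV[R]_(2 + 2) := (vec4 a b c d)^T.

Lemma col4E (a b c d : R) (i : 'I_(2 + 2)) : col4 a b c d i 0 = nth 0 [:: a; b; c; d] i.
Proof. by rewrite !mxE. Qed.

Lemma row_mul_col_eq0 v th :
  v *m th = 0 <-> \sum_i v 0 i * th i 0 = 0.
Proof.
split=> [/matrixP /(_ 0 0)|h]; first by rewrite !mxE.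
by apply/matrixP => i j; rewrite !ord1 !mxE.
Qed.

(** [cov0] and [cov1] are the two equations of [in_graph] read as covectors. *)
Definition cov0 z k := col4 (- k * turn0 z (vec4 1 0 0 0)) (- k * turn0 z (vec4 0 1 0 0)) 1 0.
Definition cov1 z k := col4 (- k * turn1 z (vec4 1 0 0 0)) (- k * turn1 z (vec4 0 1 0 0)) 0 1.

Lemma coE_col th (i : 'I_(2 + 2)) : th i 0 = co th^T i.
Proof. by rewrite -coE mxE. Qed.

Lemma annihilator_graph_plane z k :
  annihilator_basis (cov0 z k) (cov1 z k) (graph_plane z k).
Proof.
split.
  rewrite free_cons span_seq1 seq1_free; apply/andP; split.
    apply/negP => /vlineP[c] /(congr1 (fun th => co th^T 2)) /=.
    rewrite linearZ /= coZ /cov0 /cov1 /col4 !trmxK !co_vec4 //= mulr0 => /eqP.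
    by rewrite oner_eq0.
  apply/eqP => /(congr1 (fun th => co th^T 3)) /=.
  by rewrite /cov1 /col4 trmxK !co_vec4 //= /co !mxE => /eqP; rewrite oner_eq0.
move=> th; rewrite span_cons span_seq1; split=> [ann|].
  have /row_mul_col_eq0 := ann (graph_vec z k 1 0) (memv_span (mem_head _ _)).
  have /row_mul_col_eq0 := ann (graph_vec z k 0 1) (memv_span (mem_last _ [:: _])).
  under eq_bigr do rewrite coE_col coE.
  under [in X in _ -> X -> _]eq_bigr do rewrite coE_col coE.
  rewrite !big_ord_recl !big_ord0 /= /bump /= !addn0 !add1n !co_vec4 //= => e1 e0.
  apply/memv_addP; exists (co th^T 2 *: cov0 z k); first exact/memvZ/memv_line.
  exists (co th^T 3 *: cov1 z k); first exact/memvZ/memv_line.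
  apply: trmx_inj; apply: coP.
  rewrite linearD !linearZ /= !coD !coZ /cov0 /cov1 /col4 !trmxK !co_vec4 //=.
  by split; lra.
case/memv_addP => u /vlineP[c ->] [u' /vlineP[d ->] ->] v /mem_graph_plane[v2 v3].
apply/row_mul_col_eq0; under eq_bigr do rewrite coE_col coE.
rewrite !big_ord_recl !big_ord0 /= /bump /= !addn0 !add1n.
rewrite linearD !linearZ /= !coD !coZ /cov0 /cov1 /col4 !trmxK !co_vec4 //=.
by rewrite v2 v3 /turn0 /turn1 /area !co_vec4 //=; ring.
Qed.

Lemma SD_graph_plane z k : rho z != 0 -> SD_null_plane (metric z) (graph_plane z k).
Proof.
move=> rz; split; first exact: null_graph_plane.
exists (cov0 z k), (cov1 z k); split; first exact: annihilator_graph_plane.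
apply/matrixP => i j; rewrite hodge_wedge //.
have WE : wedge (cov0 z k) (cov1 z k) i j =
    cov0 z k i 0 * cov1 z k j 0 - cov1 z k i 0 * cov0 z k j 0.
  by rewrite !mxE !big_ord1 !mxE.
rewrite WE /raise.
have sumE th (a : nat) : \sum_(b < 2 + 2) inv_metric_coef z a b * th b 0 =
   inv_metric_coef z a 0 * co th^T 0 + inv_metric_coef z a 1 * co th^T 1
   + inv_metric_coef z a 2 * co th^T 2 + inv_metric_coef z a 3 * co th^T 3.
  under eq_bigr do rewrite coE_col.
  by rewrite !big_ord_recl !big_ord0 /= /bump /= !addn0 !add1n addr0 !addrA.
rewrite !sumE !col4E !trmxK !co_vec4 //= /turn0 /turn1 /area !co_vec4 //=.
move: rz; rewrite /rho => rz.
by case: i {WE} => [[|[|[|[|//]]]] ?]; case: j => [[|[|[|[|//]]]] ?]; rewrite /=; field.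
Qed.

End Graph.

(** * Plücker coordinates of self-dual null planes *)

Section GraphConverse.
Context {R : realType}.
Implicit Types (z v w : 'rV[R]_(2 + 2)) (k : R) (th : 'cV[R]_(2 + 2)).

Lemma raiseE z th (a : nat) : raise z th a =
   inv_metric_coef z a 0 * co th^T 0 + inv_metric_coef z a 1 * co th^T 1
   + inv_metric_coef z a 2 * co th^T 2 + inv_metric_coef z a 3 * co th^T 3.
Proof.
rewrite /raise; under eq_bigr do rewrite coE_col.
by rewrite !big_ord_recl !big_ord0 /= /bump /= !addn0 !add1n addr0 !addrA.
Qed.

Definition plucker (th1 th2 : 'cV[R]_(2 + 2)) (a b : nat) : R :=
  co th1^T a * co th2^T b - co th2^T a * co th1^T b.

(* The mixed part T of th1 /\ th2 satisfies *T = H adj(H^-1 T), hence self-duality says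
   that H^-1 T is its own adjugate, i.e. a scalar matrix, H being minus the mixed block of the metric. *)
Lemma SD_plucker z (th1 th2 : 'cV[R]_(2 + 2)) : rho z != 0 ->
  hodge (metric z) (wedge th1 th2) = wedge th1 th2 ->
  exists s, [/\ plucker th1 th2 0 2 = s * (1 + co z 1 * co z 3),
    plucker th1 th2 0 3 = - s * (co z 1 * co z 2),
    plucker th1 th2 1 2 = - s * (co z 0 * co z 3) &
    plucker th1 th2 1 3 = s * (1 + co z 0 * co z 2)].
Proof.
move=> rz /matrixP sd; pose p := plucker th1 th2.
pose h (a b : 'I_(2 + 2)) := hodge (metric z) (wedge th1 th2) a b.
have E (a b : nat) (a4 : (a < 4)%N) (b4 : (b < 4)%N) : p a b - h (Ordinal a4) (Ordinal b4) = 0.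
  rewrite /h sd /p /plucker !mxE !big_ord1 !mxE !coE_col /=; ring.
have := (E 0%N 2%N isT isT, E 0%N 3%N isT isT, E 1%N 2%N isT isT, E 1%N 3%N isT isT).
move=> [[[E02 E03] E12] E13].
(* N is adj(H) T, with H scaled by rho^2 so that its determinant is rho. Applied to T minus its
   dual, adj(H) gives N - adj(N): off the diagonal this is 2 N01 and 2 N10, and its first diagonal
   entry is N00 - N11. The zeros in the [transitivity] steps stand for entries of T minus its
   dual. *)
pose N00 := (1 + co z 0 * co z 2) * p 0%N 2%N + co z 2 * co z 1 * p 1%N 2%N.
pose N01 := (1 + co z 0 * co z 2) * p 0%N 3%N + co z 2 * co z 1 * p 1%N 3%N.
pose N10 := co z 3 * co z 0 * p 0%N 2%N + (1 + co z 1 * co z 3) * p 1%N 2%N.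
pose N11 := co z 3 * co z 0 * p 0%N 3%N + (1 + co z 1 * co z 3) * p 1%N 3%N.
have e01 : N01 = 0.
  apply/eqP; rewrite -(mulrI_eq0 _ (mulfI (_ : 2 != 0))) ?pnatr_eq0 //; apply/eqP.
  transitivity ((1 + co z 0 * co z 2) * 0 + co z 2 * co z 1 * 0 : R); last by ring.
  rewrite -[X in _ = _ * X + _]E03 -[X in _ = _ + _ * X]E13 /N01 /h !hodge_wedge //= !raiseE.
  by rewrite /p /plucker /=; move: rz; rewrite /rho => rz; field.
have e10 : N10 = 0.
  apply/eqP; rewrite -(mulrI_eq0 _ (mulfI (_ : 2 != 0))) ?pnatr_eq0 //; apply/eqP.
  transitivity (co z 3 * co z 0 * 0 + (1 + co z 1 * co z 3) * 0 : R); last by ring.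
  rewrite -[X in _ = _ * X + _]E02 -[X in _ = _ + _ * X]E12 /N10 /h !hodge_wedge //= !raiseE.
  by rewrite /p /plucker /=; move: rz; rewrite /rho => rz; field.
have e00 : N00 - N11 = 0.
  transitivity ((1 + co z 0 * co z 2) * 0 + co z 2 * co z 1 * 0 : R); last by ring.
  rewrite -[X in _ = _ * X + _]E02 -[X in _ = _ + _ * X]E12 /N00 /N11 /h !hodge_wedge //= !raiseE.
  by rewrite /p /plucker /=; move: rz; rewrite /rho => rz; field.
exists (N00 / rho z); rewrite -/p; split.
- transitivity (((1 + co z 1 * co z 3) * N00 - co z 2 * co z 1 * N10) / rho z).
    by rewrite /N00 /N10; move: rz; rewrite /rho => rz; field.
  by rewrite e10; ring.
- transitivity (((1 + co z 1 * co z 3) * N01 - co z 2 * co z 1 * (N00 - (N00 - N11))) / rho z).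
    by rewrite /N01 /N11 /N00; move: rz; rewrite /rho => rz; field.
  by rewrite e01 e00; ring.
- transitivity (((1 + co z 0 * co z 2) * N10 - co z 3 * co z 0 * N00) / rho z).
    by rewrite /N00 /N10; move: rz; rewrite /rho => rz; field.
  by rewrite e10; ring.
- transitivity (((1 + co z 0 * co z 2) * (N00 - (N00 - N11)) - co z 3 * co z 0 * N01) / rho z).
    by rewrite /N01 /N11 /N00; move: rz; rewrite /rho => rz; field.
  by rewrite e01 e00; ring.
Qed.

Lemma plucker_neq0 (th1 th2 : 'cV[R]_(2 + 2)) : free [:: th1; th2] ->
  exists a b, [/\ (a < 4)%N, (b < 4)%N & plucker th1 th2 a b != 0].
Proof.
rewrite free_cons span_seq1 seq1_free => /andP[th12 th2_neq0].
have [b thb] : exists b, th2 b 0 != 0.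
  apply/existsP; apply: contraNT th2_neq0 => /existsPn h; apply/eqP/colP => b.
  by rewrite mxE; apply/eqP; rewrite -[_ == _]negbK h.
have [a pa] : exists a, th1 a 0 * th2 b 0 - th2 a 0 * th1 b 0 != 0.
  apply/existsP; apply: contraNT th12 => /existsPn h.
  apply/vlineP; exists (th1 b 0 / th2 b 0); apply/colP => a; rewrite mxE.
  have := h a; rewrite negbK subr_eq0 => /eqP e.
  by rewrite mulrAC [th1 b 0 * _]mulrC -e mulfK.
by exists a, b; rewrite !ltn_ord /plucker -!coE_col.
Qed.

(** Contracting th1 /\ th2 with w in W gives 0. With the mixed coordinates known up to the factor s,
    the components 2 and 3 of this relation are the graph equations multiplied by p23, so k = s /
    p23. *)
Lemma SD_null_plane_graph z (W : {vspace 'rV[R]_(2 + 2)}) v : rho z != 0 ->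
  SD_null_plane (metric z) W -> v \in W -> (co v 0, co v 1) != (0, 0) ->
  exists k, forall w, w \in W -> in_graph z k w.
Proof.
move=> rz [_ [th1 [th2 [[fr ann] sd]]]] vW v0.
have [s [p02 p03 p12 p13]] := SD_plucker rz sd.
set p := plucker th1 th2 in p02 p03 p12 p13.
have sumE w th : w *m th = 0 -> co w 0 * co th^T 0 + co w 1 * co th^T 1
    + co w 2 * co th^T 2 + co w 3 * co th^T 3 = 0.
  move=> /row_mul_col_eq0; under eq_bigr do rewrite coE_col coE.
  by rewrite !big_ord_recl !big_ord0 /= /bump /= !addn0 !add1n addr0 !addrA.
have pW w (b : nat) : w \in W -> co w 0 * p 0%N b + co w 1 * p 1%N b
    + co w 2 * p 2%N b + co w 3 * p 3%N b = 0.
  move=> wW; rewrite /p /plucker.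
  have /ann/(_ w wW)/sumE e1 : th1 \in <<[:: th1; th2]>>%VS by rewrite memv_span ?mem_head.
  have /ann/(_ w wW)/sumE e2 : th2 \in <<[:: th1; th2]>>%VS by apply/memv_span/(mem_last th1 [:: th2]).
  transitivity (0 * co th2^T b - 0 * co th1^T b); last by ring.
  by rewrite -[in X in _ = X - _]e1 -e2; ring.
have pp a b : p a b = - p b a by rewrite /p /plucker; ring.
have p2 w : w \in W -> s * turn1 z w = p 2%N 3%N * co w 3.
  move=> wW; have := pW w 2%N wW.
  rewrite p02 p12 (pp 3%N 2%N) (_ : p 2%N 2%N = 0); last by rewrite /p /plucker; ring.
  by rewrite /turn1 /area => e; apply/eqP; rewrite -subr_eq0 -[X in _ == X]e; apply/eqP; ring.
have p3 w : w \in W -> s * turn0 z w = p 2%N 3%N * co w 2.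
  move=> wW; have := pW w 3%N wW.
  rewrite p03 p13 (_ : p 3%N 3%N = 0); last by rewrite /p /plucker; ring.
  by rewrite /turn0 /area => e; apply/eqP; rewrite -subr_eq0 -oppr_eq0 -[X in _ == X]e; apply/eqP; ring.
(* If p23 = 0, then s = 0 because the turned x-part of v is not 0; only p01 survives, so W lies in
   x' = 0, which v excludes. *)
have om0 : p 2%N 3%N != 0.
  apply/eqP => om.
  have vv : co v 0 = 0 -> co v 1 = 0 -> False by move=> e0 e1; rewrite e0 e1 eqxx in v0.
  have s0 : s = 0.
    apply/eqP/negPn/negP => s0; have := p2 v vW; have := p3 v vW.
    rewrite om !mul0r => /eqP + /eqP; rewrite !mulf_eq0 (negPf s0) /=.
    by move=> /eqP r0 /eqP r1; have [/vv] := turn_eq0 rz r0 r1.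
  rewrite s0 oppr0 !mul0r in p02 p03 p12 p13.
  have paa c : p c c = 0 by rewrite /p /plucker; ring.
  have p01 : p 0%N 1%N != 0.
    have [a [b [a4 b4]]] := plucker_neq0 fr; apply: contra_neq => p01.
    rewrite -/p; case: a a4 => [|[|[|[|//]]]] _; case: b b4 => [|[|[|[|//]]]] _;
      rewrite ?paa ?p01 ?p02 ?p03 ?p12 ?p13 ?om //;
      by rewrite pp ?p01 ?p02 ?p03 ?p12 ?p13 ?om oppr0.
  have := pW v 1%N vW; have := pW v 0%N vW.
  rewrite (pp 2%N 0%N) (pp 3%N 0%N) (pp 2%N 1%N) (pp 3%N 1%N) p02 p03 p12 p13 !paa.
  rewrite (pp 1%N 0%N) oppr0 !mulr0 !addr0 add0r mulrN => /eqP.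
  rewrite oppr_eq0 mulf_eq0 (negPf p01) orbF => /eqP v1 /eqP.
  by rewrite mulf_eq0 (negPf p01) orbF => /eqP /vv /(_ v1).
exists (s / p 2%N 3%N) => w wW; split.
  by rewrite mulrAC p3 // mulrC mulKf.
by rewrite mulrAC p2 // mulrC mulKf.
Qed.

End GraphConverse.

(** * Christoffel symbols and the covariant derivative *)

Section LeviCivita.
Context {R : realType}.
Implicit Types (z v w : 'rV[R]_(2 + 2)) (m : 'I_3).

(** The closed form of the metric holds where rho is not 0; differentiating it requires this on a
    neighbourhood. *)
Lemma near_rho_neq0 z : rho z != 0 -> \forall y \near z, rho y != 0.
Proof.
have c n : (fun y : 'rV[R]_(2 + 2) => co y n) @ z --> co z n.
  exact/differentiable_continuous/differentiable_coord.
have cr : @rho R @ z --> rho z.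
  exact: cvgD (cvgD (cvg_cst _) (cvgM (c _) (c _))) (cvgM (c _) (c _)).
exact: cvgr_neq0 cr.
Qed.

Definition dmetric_coef z v (a b : nat) : R :=
  let d f df := (df * rho z - f * (2 * drho z v)) / rho z ^+ 3 in
  match a, b with
  | 0%N, 2%N | 2%N, 0%N => d (- (1 + co z 1 * co z 3)) (- (co z 1 * co v 3 + co z 3 * co v 1))
  | 1%N, 3%N | 3%N, 1%N => d (- (1 + co z 0 * co z 2)) (- (co z 0 * co v 2 + co z 2 * co v 0))
  | 0%N, 3%N | 3%N, 0%N => d (co z 1 * co z 2) (co z 1 * co v 2 + co z 2 * co v 1)
  | 1%N, 2%N | 2%N, 1%N => d (co z 0 * co z 3) (co z 0 * co v 3 + co z 3 * co v 0)
  | _, _ => 0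
  end.

Lemma is_derive_metric_coef z v (a b : nat) : rho z != 0 ->
  is_derive z v (fun y => metric_coef y a b) (dmetric_coef z v a b).
Proof.
move=> rz; have c n := is_derive_co z v n.
have div (f : 'rV[R]_(2 + 2) -> R) (df : R) : is_derive z v f df ->
    is_derive z v (fun y => f y / rho y ^+ 2)
    ((df * rho z - f z * (2 * drho z v)) / rho z ^+ 3).
  move=> hf; rewrite (_ : (fun y => _) = fun y => f y * ((rho y)^-1 * (rho y)^-1)); last first.
    by apply/funext => y; rewrite -invfM expr2.
  have hr := is_derive_invf rz (is_derive_rho z v).
  apply: (is_derive_eq (is_derive_mulf hf (is_derive_mulf hr hr))).
  by move: (rho z) rz => r rz; field.
have one (i j : nat) := is_derive_oppf
  (is_derive_addf (is_derive_cst (1 : R) z v) (is_derive_mulf (c i) (c j))).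
have h02 := div _ _ (is_derive_eq (one 1%N 3%N) (congr1 -%R (add0r _))).
have h13 := div _ _ (is_derive_eq (one 0%N 2%N) (congr1 -%R (add0r _))).
have h03 := div _ _ (is_derive_mulf (c 1%N) (c 2%N)).
have h12 := div _ _ (is_derive_mulf (c 0%N) (c 3%N)).
have h0 := is_derive_cst (0 : R) z v.
rewrite /metric_coef /dmetric_coef.
by case: a => [|[|[|[|a]]]]; case: b => [|[|[|[|b]]]].
Qed.

Lemma partial_dancing_metric m z (i a b : 'I_(2 + 2)) : rho z != 0 ->
  partial i (fun y => dancing_metric m y a b) z = dmetric_coef z (delta_mx 0 i) a b.
Proof.
move=> rz; have [_ <-] := is_derive_metric_coef (delta_mx 0 i) a b rz.
apply: near_eq_derive; near=> y.
have ry : rho y != 0 by near: y; exact: near_rho_neq0.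
by rewrite dancing_metricE // mxE.
Unshelve. all: by end_near. Qed.

(** The shifts by 2 exchange matching x and y indices: the symbols come from the 1-form - y.dx / rho
    on the x-block and - x.dy / rho on the y-block. *)
Definition symbol z (k i j : nat) : R :=
  if [&& (k < 2)%N, (i < 2)%N & (j < 2)%N] then
    - (co z (i + 2) * (k == j)%:R + co z (j + 2) * (k == i)%:R) / rho z
  else if [&& (2 <= k)%N, (2 <= i)%N & (2 <= j)%N] then
    - (co z (i - 2) * (k == j)%:R + co z (j - 2) * (k == i)%:R) / rho z
  else 0.

Lemma christoffelE m z (k i j : 'I_(2 + 2)) : rho z != 0 ->
  christoffel (dancing_metric m) z k i j = symbol z k i j.
Proof.
move=> rz; rewrite /christoffel dancing_metricE // invmx_metric //.
under eq_bigr do rewrite mxE !partial_dancing_metric //.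
rewrite !big_ord_recl big_ord0 /= /bump /= !addn0 !add1n.
rewrite /dmetric_coef /drho !co_delta // /inv_metric_coef /symbol.
move: rz; rewrite /rho => rz.
by case: k => [[|[|[|[|//]]]] ?]; case: i => [[|[|[|[|//]]]] ?];
  case: j => [[|[|[|[|//]]]] ?]; rewrite /= ?(addn2, subn2) /=; field.
Qed.

Lemma cov_deriv_vec4 m (c V : R -> 'rV[R]_(2 + 2)) t : rho (c t) != 0 ->
  let z := c t in let c' := derive1 c t in let V' := derive1 V t in let v := V t in
  cov_deriv (dancing_metric m) c V t = vec4
    (co V' 0 - ((co z 2 * co v 0 + co z 3 * co v 1) * co c' 0
              + (co z 2 * co c' 0 + co z 3 * co c' 1) * co v 0) / rho z)
    (co V' 1 - ((co z 2 * co v 0 + co z 3 * co v 1) * co c' 1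
              + (co z 2 * co c' 0 + co z 3 * co c' 1) * co v 1) / rho z)
    (co V' 2 - ((co z 0 * co v 2 + co z 1 * co v 3) * co c' 2
              + (co z 0 * co c' 2 + co z 1 * co c' 3) * co v 2) / rho z)
    (co V' 3 - ((co z 0 * co v 2 + co z 1 * co v 3) * co c' 3
              + (co z 0 * co c' 2 + co z 1 * co c' 3) * co v 3) / rho z).
Proof.
move=> rz z c' V' v; apply/rowP => k; rewrite !mxE coE -/V'.
under eq_bigr do under eq_bigr do rewrite christoffelE // !coE -/z -/c' -/v.
clearbody z c' V' v; rewrite !big_ord_recl !big_ord0 /= /bump /= !addn0 !add1n /symbol.
by case: k => [[|[|[|[|//]]]] ?]; rewrite /= ?(addn2, subn2) /=; ring.
Qed.

Lemma cov_derivE m (c V : R -> 'rV[R]_(2 + 2)) t : rho (c t) != 0 ->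
  let z := c t in let c' := derive1 c t in let V' := derive1 V t in let v := V t in
  let D := cov_deriv (dancing_metric m) c V t in
  [/\ co D 0 = co V' 0 - ((co z 2 * co v 0 + co z 3 * co v 1) * co c' 0
              + (co z 2 * co c' 0 + co z 3 * co c' 1) * co v 0) / rho z,
      co D 1 = co V' 1 - ((co z 2 * co v 0 + co z 3 * co v 1) * co c' 1
              + (co z 2 * co c' 0 + co z 3 * co c' 1) * co v 1) / rho z,
      co D 2 = co V' 2 - ((co z 0 * co v 2 + co z 1 * co v 3) * co c' 2
              + (co z 0 * co c' 2 + co z 1 * co c' 3) * co v 2) / rho z &
      co D 3 = co V' 3 - ((co z 0 * co v 2 + co z 1 * co v 3) * co c' 3
              + (co z 0 * co c' 2 + co z 1 * co c' 3) * co v 3) / rho z].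
Proof.
move=> rz z c' V' v D; rewrite /D cov_deriv_vec4 //.
by split; apply: co_vec4.
Qed.

End LeviCivita.

(** The algebra of [cov_deriv_graph] in independent variables, as [field] wants it: u and du are the
    x-parts of V and V', a is that of the velocity, and v and b are the y-parts of V and of the
    velocity. *)
Lemma cov_deriv_graph_eq (F : fieldType) (x0 x1 y0 y1 u0 u1 a0 a1 du0 du1 k dk : F) :
  let area b0 b1 := x1 * b0 - x0 * b1 in
  let t0 b0 b1 := - b1 + y0 * area b0 b1 in
  let t1 b0 b1 := b0 + y1 * area b0 b1 in
  let r := 1 + x0 * y0 + x1 * y1 in
  let D0 := du0 - ((y0 * u0 + y1 * u1) * a0 + (y0 * a0 + y1 * a1) * u0) / r in
  let D1 := du1 - ((y0 * u0 + y1 * u1) * a1 + (y0 * a0 + y1 * a1) * u1) / r in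
  let darea := x1 * du0 + u0 * a1 + - (x0 * du1 + u1 * a0) in
  let b0 := k * t0 a0 a1 in let b1 := k * t1 a0 a1 in
  let v0 := k * t0 u0 u1 in let v1 := k * t1 u0 u1 in
  let d := dk - k * (k * area a0 a1 - 2 * (y0 * a0 + y1 * a1) / r) in
  r != 0 ->
  k * (- du1 + (y0 * darea + area u0 u1 * b0)) + t0 u0 u1 * dk
    - ((x0 * v0 + x1 * v1) * b0 + (x0 * b0 + x1 * b1) * v0) / r - k * t0 D0 D1
   = d * t0 u0 u1 /\
  k * (du0 + (y1 * darea + area u0 u1 * b1)) + t1 u0 u1 * dk
    - ((x0 * v0 + x1 * v1) * b1 + (x0 * b0 + x1 * b1) * v1) / r - k * t1 D0 D1
   = d * t1 u0 u1.
Proof. by cbv zeta beta => r0; split; field. Qed.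

(** * Parallel graph planes along a curve, and lifts in a chart *)

Section Curves.
Context {R : realType}.
Implicit Types (z v w : 'rV[R]_(2 + 2)) (J : set R) (c : R -> 'rV[R]_(2 + 2)) (i : 'I_3).

Lemma chart_domE i z : chart_dom i z <-> rho z != 0.
Proof. by rewrite /chart_dom /= rhoE. Qed.

Lemma is_derive_co_curve c t n : derivable c t 1 ->
  is_derive t 1 (fun s => co (c s) n) (co (derive1 c t) n).
Proof. by move=> dc; exact/is_derive_mx/is_derive_derive1. Qed.

Lemma is_derive_rho_curve c t : derivable c t 1 ->
  is_derive t 1 (fun s => rho (c s)) (drho (c t) (derive1 c t)).
Proof.
move=> dc; have d n := is_derive_co_curve n dc.
have h := is_derive_addf (is_derive_addf (is_derive_cst (1 : R) t 1)
  (is_derive_mulf (d 0%N) (d 2%N))) (is_derive_mulf (d 1%N) (d 3%N)).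
by apply: (is_derive_eq h); rewrite /drho; ring.
Qed.

(* Vanishes exactly when the planes graph_plane (c t) (k t) are parallel along c, where v = c'. *)
Definition graph_defect (k k' : R) z v : R :=
  k' - k * (k * area z v - 2 * (co z 2 * co v 0 + co z 3 * co v 1) / rho z).

(** The derivatives of the x-part of V cancel, so the deviation of the covariant derivative from the
    graph is pointwise linear in V, with one scalar factor. That is why a single field with non-zero
    x-part decides parallelism. *)
Lemma cov_deriv_graph i J c (V : R -> 'rV[R]_(2 + 2)) (k : R -> R) t :
  open J -> J t -> rho (c t) != 0 ->
  derivable c t 1 -> derivable V t 1 -> derivable k t 1 ->
  (forall s, J s -> in_graph (c s) (k s) (V s)) ->
  in_graph (c t) (k t) (derive1 c t) ->
  let D := cov_deriv (dancing_metric i) c V t in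
  let d := graph_defect (k t) (derive1 k t) (c t) (derive1 c t) in
  co D 2 - k t * turn0 (c t) D = d * turn0 (c t) (V t) /\
  co D 3 - k t * turn1 (c t) D = d * turn1 (c t) (V t).
Proof.
move=> oJ Jt rz dc dV dk gV [c2 c3] D d.
have hc n := is_derive_co_curve n dc; have hV n := is_derive_co_curve n dV.
have hk := is_derive_derive1 dk.
have ha := is_derive_addf (is_derive_mulf (hc 1%N) (hV 0%N))
  (is_derive_oppf (is_derive_mulf (hc 0%N) (hV 1%N))).
have h0 := is_derive_mulf hk (is_derive_addf (is_derive_oppf (hV 1%N)) (is_derive_mulf (hc 2%N) ha)).
have h1 := is_derive_mulf hk (is_derive_addf (hV 0%N) (is_derive_mulf (hc 3%N) ha)).
have e2 := is_derive_derive1E h0; have e3 := is_derive_derive1E h1.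
(* The graph equations hold on the open set J, so they may be differentiated to obtain the y-part of
   V'. *)
rewrite -(@eq_derive1 _ _ J (fun s => co (V s) 2)) // in e2; last first.
  by move=> s /[!inE] Js; have [-> _] := gV s Js.
rewrite -(@eq_derive1 _ _ J (fun s => co (V s) 3)) // in e3; last first.
  by move=> s /[!inE] Js; have [_ ->] := gV s Js.
rewrite (is_derive_derive1E (hV 2%N)) in e2; rewrite (is_derive_derive1E (hV 3%N)) in e3.
have [v2 v3] := gV t Jt.
have [D0 D1 D2 D3] := cov_derivE i V rz.
rewrite -/D e2 v2 v3 c2 c3 in D2; rewrite -/D e3 v2 v3 c2 c3 in D3; rewrite -/D in D0 D1.
rewrite /d /graph_defect /turn0 /turn1 /area D0 D1 D2 D3.
exact: (@cov_deriv_graph_eq R (co (c t) 0) (co (c t) 1) (co (c t) 2) (co (c t) 3)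
  (co (V t) 0) (co (V t) 1) (co (derive1 c t) 0) (co (derive1 c t) 1)
  (co (derive1 V t) 0) (co (derive1 V t) 1) (k t) (derive1 k t) rz).
Qed.

Lemma in_graph_inj z k1 k2 v : rho z != 0 -> (co v 0, co v 1) != (0, 0) ->
  in_graph z k1 v -> in_graph z k2 v -> k1 = k2.
Proof.
move=> rz v0 [a0 a1] [b0 b1]; apply/eqP; rewrite -subr_eq0; apply/negPn/negP => k12.
have e0 : turn0 z v = 0.
  by apply/eqP; rewrite -[_ == _](mulrI_eq0 _ (mulfI k12)) mulrBl -a0 -b0 subrr.
have e1 : turn1 z v = 0.
  by apply/eqP; rewrite -[_ == _](mulrI_eq0 _ (mulfI k12)) mulrBl -a1 -b1 subrr.
by have [z0 z1] := turn_eq0 rz e0 e1; rewrite z0 z1 eqxx in v0.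
Qed.

Lemma vlines_eq (U : vectType R) (u v : U) : <[u]>%VS = <[v]>%VS -> exists a, u = a *: v.
Proof. by move=> uv; apply/vlineP; rewrite -uv memv_line. Qed.

Lemma vline_scale (V : vectType R) (u : V) (a : R) : a != 0 -> <[a *: u]>%VS = <[u]>%VS.
Proof.
move=> a0; apply/eqP; rewrite eqEsubv -!memvE memvZ ?memv_line //=.
by apply/vlineP; exists a^-1; rewrite scalerA mulVf // scale1r.
Qed.

Lemma Pi_chart i z (Q : ambient R) : Q5 Q -> Pi Q = chart i z ->
  let mu := Q.1 i 0 in let nu := Q.2 0 i in
  [/\ Q = (col3 (ins i mu (mu * co z 0) (mu * co z 1)),
           row3 (ins i nu (nu * co z 2) (nu * co z 3))) & nu * mu * rho z = 1].
Proof.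
case: Q => q p; rewrite /Q5 /= => pq PQ.
have [a /= qE] := vlines_eq (congr1 fst PQ); have [b /= pE] := vlines_eq (congr1 snd PQ).
have aE : q i 0 = a.
  by rewrite qE chart_qE scale_col3_ins mxE; case: i {PQ pE qE} => [[|[|[|//]]] ?] /=; rewrite mulr1.
have bE : p 0 i = b.
  by rewrite pE chart_pE scale_row3_ins mxE; case: i {PQ aE pE qE} => [[|[|[|//]]] ?] /=; rewrite mulr1.
rewrite aE bE; split.
  by rewrite {1}qE {1}pE chart_qE chart_pE scale_col3_ins scale_row3_ins !mulr1.
by rewrite -pq qE pE pairingZl pairingZr rhoE mulrA.
Qed.

Section Lift.
Variables (i : 'I_3) (J : set R) (c : R -> 'rV[R]_(2 + 2)) (mu nu : R -> R).
Variables (gam : R -> ambient R) (t : R).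
Hypotheses (oJ : open J) (Jt : J t) (dc : derivable c t 1) (dmu : derivable mu t 1)
  (dnu : derivable nu t 1).
Hypothesis gamE : forall s, J s ->
  gam s = (col3 (ins i (mu s) (mu s * co (c s) 0) (mu s * co (c s) 1)),
           row3 (ins i (nu s) (nu s * co (c s) 2) (nu s * co (c s) 3))).

Let x0 := co (c t) 0. Let x1 := co (c t) 1.
Let y0 := co (c t) 2. Let y1 := co (c t) 3.
Let dx0 := co (derive1 c t) 0. Let dx1 := co (derive1 c t) 1.
Let dy0 := co (derive1 c t) 2. Let dy1 := co (derive1 c t) 3.
Let m := mu t. Let n := nu t. Let dm : R := derive1 mu t. Let dn : R := derive1 nu t.

Lemma velocity_lift : velocity gam t =
  (col3 (ins i dm (m * dx0 + x0 * dm) (m * dx1 + x1 * dm)),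
   row3 (ins i dn (n * dy0 + y0 * dn) (n * dy1 + y1 * dn))).
Proof.
have hc k := is_derive_co_curve k dc.
have hm := is_derive_derive1 dmu; have hn := is_derive_derive1 dnu.
congr (_, _).
  rewrite (@eq_derive1 _ _ J _ (fun s => col3 (ins i (mu s) (mu s * co (c s) 0) (mu s * co (c s) 1)))) //.
    exact: (is_derive_derive1E (is_derive_col3_ins i hm
      (is_derive_mulf hm (hc 0%N)) (is_derive_mulf hm (hc 1%N)))).
  by move=> s /[!inE] Js; rewrite /= gamE.
rewrite (@eq_derive1 _ _ J _ (fun s => row3 (ins i (nu s) (nu s * co (c s) 2) (nu s * co (c s) 3)))) //.
  exact: (is_derive_derive1E (is_derive_row3_ins i hn
      (is_derive_mulf hn (hc 2%N)) (is_derive_mulf hn (hc 3%N)))).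
by move=> s /[!inE] Js; rewrite /= gamE.
Qed.

(** The i-th coordinate of P' = Q * Q' (cross product) gives nu'; subtracting y times it from the
    other two gives the graph equations. As P' Q = (Q * Q') Q = 0, tangency to Q^5 reduces to P Q' =
    0, the first equation. *)
Lemma distr_lift : distr (gam t) (velocity gam t) <->
  [/\ n * (dm * rho (c t) + m * (y0 * dx0 + y1 * dx1)) = 0,
      dn = - chart_sign i * m ^+ 2 * area (c t) (derive1 c t),
      n * dy0 = chart_sign i * m ^+ 2 * turn0 (c t) (derive1 c t) &
      n * dy1 = chart_sign i * m ^+ 2 * turn1 (c t) (derive1 c t)].
Proof.
rewrite velocity_lift gamE // /distr /TQ5 /= cross_ins scale_row3_ins.
rewrite -/x0 -/x1 -/y0 -/y1 -/m -/n !pairing_ins.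
rewrite /turn0 /turn1 /area -/x0 -/x1 -/y0 -/y1 -/dx0 -/dx1 /rho -/x0 -/x1 -/y0 -/y1.
split=> [[tq] /row3_ins_inj[e e0 e1]|[e dnE e0 e1]].
  have dnE : dn = - chart_sign i * m ^+ 2 * (x1 * dx0 - x0 * dx1) by rewrite e; ring.
  split=> //.
  - rewrite e0 e1 e in tq; rewrite -[RHS]tq; ring.
  - by rewrite (_ : n * dy0 = n * dy0 + y0 * dn - y0 * dn); [rewrite e0 dnE; ring | ring].
  - by rewrite (_ : n * dy1 = n * dy1 + y1 * dn - y1 * dn); [rewrite e1 dnE; ring | ring].
have -> : n * dy0 + y0 * dn = chart_sign i * (dm * (m * x1) - m * (m * dx1 + x1 * dm)).
  by rewrite e0 dnE; ring.
have -> : n * dy1 + y1 * dn = chart_sign i * (m * (m * dx0 + x0 * dm) - dm * (m * x0)).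
  by rewrite e1 dnE; ring.
have -> : dn = chart_sign i * (m * x0 * (m * dx1 + x1 * dm) - m * x1 * (m * dx0 + x0 * dm)).
  by rewrite dnE; ring.
split=> //; rewrite -[RHS]e; ring.
Qed.

End Lift.

End Curves.

(** * Integral curves seen in a chart *)

Section IntegralCurves.
Context {R : realType}.
Implicit Types (z v w : 'rV[R]_(2 + 2)) (J : set R) (c : R -> 'rV[R]_(2 + 2)) (i : 'I_3).
Implicit Types (gam : R -> ambient R).

Lemma lsubmx_eq0 v : (lsubmx v == 0 :> 'rV_2) = ((co v 0, co v 1) == (0, 0)).
Proof.
apply/eqP/eqP => [/rowP h|[v0 v1]].
  by have := h 0; have := h 1; rewrite !mxE !coE /= => -> ->.
by apply/rowP => j; rewrite !mxE coE; case: j => [[|[|//]] ?].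
Qed.

Lemma rsubmx_eq0 v : (rsubmx v == 0 :> 'rV_2) = ((co v 2, co v 3) == (0, 0)).
Proof.
apply/eqP/eqP => [/rowP h|[v0 v1]].
  by have := h 0; have := h 1; rewrite !mxE !coE /= => -> ->.
by apply/rowP => j; rewrite !mxE coE; case: j => [[|[|//]] ?].
Qed.

(* As nu mu rho = 1, the slope is +- mu^3 rho: a cube root recovers mu from it. *)
Definition slope i gam (t : R) : R := chart_sign i * ((gam t).1 i 0) ^+ 2 / (gam t).2 0 i.

Lemma chart_sign_neq0 i : chart_sign i != 0 :> R.
Proof. by rewrite /chart_sign signr_eq0. Qed.

Lemma chart_sign_sqr i : chart_sign i * chart_sign i = 1 :> R.
Proof. by rewrite /chart_sign -expr2 sqrr_sign. Qed.

Lemma ins0 i : (col3 (ins i 0 0 0), row3 (ins i 0 0 0)) = 0 :> ambient R.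
Proof.
congr (_, _); apply/matrixP => a b; rewrite !mxE.
  by case: i => [[|[|[|//]]] ?]; case: a => [[|[|[|//]]] ?].
by case: i => [[|[|[|//]]] ?]; case: b => [[|[|[|//]]] ?].
Qed.

Lemma integral_curve_chart i J c gam t : open J -> integral_curve J gam ->
  chart_rep (@Pi R \o gam) i J c -> J t ->
  let k := slope i gam in
  [/\ (gam t).2 0 i * (gam t).1 i 0 * rho (c t) = 1,
      in_graph (c t) (k t) (derive1 c t),
      (co (derive1 c t) 0, co (derive1 c t) 1) != (0, 0), k t != 0 &
      derivable k t 1 /\ graph_defect (k t) (derive1 k t) (c t) (derive1 c t) = 0].
Proof.
move=> oJ [sq sp hgam] [_ sc rep] Jt k.
pose mu s := (gam s).1 i 0; pose nu s := (gam s).2 0 i.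
have lift s : J s ->
    [/\ gam s = (col3 (ins i (mu s) (mu s * co (c s) 0) (mu s * co (c s) 1)),
                 row3 (ins i (nu s) (nu s * co (c s) 2) (nu s * co (c s) 3))) &
        nu s * mu s * rho (c s) = 1].
  by move=> Js; have [Qs _ _] := hgam s Js; have [_ e] := rep s Js; exact: Pi_chart Qs e.
have gamE s (Js : J s) := proj1 (lift s Js); have rmn s (Js : J s) := proj2 (lift s Js).
have dc : derivable c t 1 := smooth_on_derivable sc Jt.
have dmu : derivable mu t 1 by exact: (iffLR (derivable_mxP _ _ _) (smooth_on_derivable sq Jt)).
have dnu : derivable nu t 1 by exact: (iffLR (derivable_mxP _ _ _) (smooth_on_derivable sp Jt)).
have [_ v0 /(distr_lift oJ Jt dc dmu dnu gamE)[e1 e2 e3 e4]] := hgam t Jt.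
rewrite (velocity_lift oJ Jt dc dmu dnu gamE) in v0.
have := rmn t Jt; move: e1 e2 e3 e4 v0.
set m := mu t; set n := nu t; set r := rho (c t).
set dm : R := derive1 mu t; set dn : R := derive1 nu t => e1 e2 e3 e4 v0 mnr.
have [n0 m0 r0] : [/\ n != 0, m != 0 & r != 0].
  have : n * m * r != 0 by rewrite mnr oner_eq0.
  by rewrite !mulf_eq0 !negb_or -andbA => /and3P.
have dmE : dm * r = - (m * (co (c t) 2 * co (derive1 c t) 0 + co (c t) 3 * co (derive1 c t) 1)).
  by apply/eqP; rewrite -addr_eq0; move/eqP: e1; rewrite mulf_eq0 (negPf n0).
have kE : k t = chart_sign i * m ^+ 2 / n by [].
have gr : in_graph (c t) (k t) (derive1 c t).
  by split; apply: (mulfI n0); [rewrite e3 | rewrite e4]; rewrite kE; field.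
(* If x' = 0, the graph gives y' = 0 and the equations of the distribution give mu' = nu' = 0,
   against regularity. *)
have x0 : (co (derive1 c t) 0, co (derive1 c t) 1) != (0, 0).
  apply: contra_neq v0 => -[x0 x1].
  have dm0 : dm = 0.
    by apply: (mulIf r0); rewrite mul0r dmE x0 x1 !mulr0 addr0 mulr0 oppr0.
  have [y0 y1] := gr; rewrite /turn0 /turn1 in y0 y1.
  have ar : area (c t) (derive1 c t) = 0 by rewrite /area x0 x1 !mulr0 subr0.
  rewrite ar x1 mulr0 oppr0 addr0 mulr0 in y0; rewrite ar x0 mulr0 addr0 mulr0 in y1.
  rewrite e2 y0 y1 ar x0 x1 dm0 !mulr0 !addr0.
  exact: ins0.
split; [exact: mnr | exact: gr | exact: x0 | |].
  by rewrite kE !mulf_neq0 ?invr_eq0 ?expf_neq0 ?chart_sign_neq0.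
have hm := is_derive_derive1 dmu.
(* From k = +- mu^2 / nu, k' / k = 2 mu' / mu - nu' / nu, where mu' / mu = - (y.x') / rho and nu' /
   nu = - k a: this is the vanishing of the defect. *)
have hk := is_derive_mulf (is_derive_mulf (is_derive_cst (chart_sign i : R) t 1)
   (is_derive_mulf hm hm)) (is_derive_invf n0 (is_derive_derive1 dnu)).
have kf : k = (fun s => chart_sign i * (mu s * mu s) * (nu s)^-1).
  by apply/funext => s; rewrite /k /slope expr2.
split; first by rewrite kf; exact: is_derive_derivable hk.
rewrite {2}kf (is_derive_derive1E hk) -/dm -/dn -/m -/n e2 kE /graph_defect -/r.
have dmE' : dm = - (m * (co (c t) 2 * co (derive1 c t) 0 + co (c t) 3 * co (derive1 c t) 1)) / r.
  by apply: (mulIf r0); rewrite dmE divfK.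
rewrite dmE'.
move: (area _ _) (co _ _ * _ + _) => A B; rewrite /=.
by clearbody m n r; field; rewrite n0 r0.
Qed.

Lemma integral_curve_chart_rep J gam t : open J -> integral_curve J gam -> J t ->
  exists i J' c, [/\ J' t, J' `<=` J & chart_rep (@Pi R \o gam) i J' c].
Proof.
move=> oJ [sq sp hgam] Jt.
have [Qt _ _] := hgam t Jt.
have [i pqi] : exists i, (gam t).2 0 i * (gam t).1 i 0 != 0.
  apply/existsP; apply: contra_eqT Qt => /existsPn /= h.
  rewrite /pairing mxE big1 => [|j _]; first by rewrite eq_sym oner_eq0.
  by have := h j; rewrite negbK => /eqP.
pose q j s := (gam s).1 j 0; pose p j s := (gam s).2 0 j.
have sqj j : smooth_on J (q j) by exact: (iffLR (smooth_on_mx _ oJ) sq j 0).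
have spj j : smooth_on J (p j) by exact: (iffLR (smooth_on_mx _ oJ) sp 0 j).
pose J' := J `&` [set s | p i s * q i s != 0].
have JJ' : J' `<=` J by move=> s [].
have oJ' : open J'.
  rewrite openE => s [Js pqs]; apply: filterI; first exact: open_nbhs_nbhs.
  have d := smooth_on_derivable (smooth_onM oJ (spj i) (sqj i)) Js.
  have /derivable1_diffP/differentiable_continuous cs := d.
  exact: (cvgr_neq0 _ cs pqs).
have pi0 s : J' s -> p i s != 0 by move=> [_ /=]; rewrite mulf_eq0 negb_or => /andP[].
have qi0 s : J' s -> q i s != 0 by move=> [_ /=]; rewrite mulf_eq0 negb_or => /andP[].
pose c s : 'rV[R]_(2 + 2) := row_mx
  (\row_l (((gam s).1)^T 0 (lift i l) / ((gam s).1)^T 0 i))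
  (\row_l ((gam s).2 0 (lift i l) / (gam s).2 0 i)).
exists i, J', c; split=> //; split=> //.
  apply/smooth_on_mx => // a b; rewrite ord1.
  case: (split_ordP b) => l ->.
    apply: (@eq_smooth_on _ _ _ (fun s => q (lift i l) s * (q i s)^-1)) => //.
      by move=> s _; rewrite /c row_mxEl !mxE.
    apply: smooth_onM => //; last apply: smooth_onV => //;
      exact: smooth_on_sub JJ' (sqj _).
  apply: (@eq_smooth_on _ _ _ (fun s => p (lift i l) s * (p i s)^-1)) => //.
    by move=> s _; rewrite /c row_mxEr !mxE.
  apply: smooth_onM => //; last apply: smooth_onV => //;
    exact: smooth_on_sub JJ' (spj _).
move=> s Js'; have [Js _] := Js'.
have zq : chart_q i (c s) = (q i s)^-1 *: (gam s).1.
  rewrite /chart_q row_mxKl homogP ?mxE ?qi0 //.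
  by rewrite linearZ /= trmxK.
have zp : chart_p i (c s) = (p i s)^-1 *: (gam s).2.
  by rewrite /chart_p row_mxKr homogP // pi0.
have [Qs _ _] := hgam s Js.
split.
  rewrite /chart_dom /= zq zp pairingZl pairingZr Qs mulr1.
  by rewrite mulf_neq0 // invr_eq0 ?pi0 ?qi0.
by rewrite /chart zq zp !vline_scale ?invr_eq0 ?pi0 ?qi0.
Qed.

End IntegralCurves.

(** * Projection, uniqueness, local existence and gluing of lifts *)

Section Main.
Context {R : realType}.
Implicit Types (z v w : 'rV[R]_(2 + 2)) (J : set R) (c : R -> 'rV[R]_(2 + 2)) (i : 'I_3).
Implicit Types (gam : R -> ambient R).

Lemma integral_curve_sub J J' gam : J' `<=` J -> integral_curve J gam -> integral_curve J' gam.
Proof.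
by move=> JJ' [sq sp h]; split=> [||t /JJ'];
  [exact: smooth_on_sub sq | exact: smooth_on_sub sp | exact: h].
Qed.

(** The plane field is the graph of [slope]; since the slope is not 0, y' is non-zero because x'
    is. *)
Lemma integral_curve_projects J gam : open J -> integral_curve J gam ->
  nondegenerate_null_curve_with_parallel_SD_plane J (@Pi R \o gam).
Proof.
move=> oJ hgam.
have key i J' c t : J' `<=` J -> chart_rep (@Pi R \o gam) i J' c -> J' t ->
    rho (c t) != 0 /\ let k := slope i gam in
    [/\ (gam t).2 0 i * (gam t).1 i 0 * rho (c t) = 1,
      in_graph (c t) (k t) (derive1 c t),
      (co (derive1 c t) 0, co (derive1 c t) 1) != (0, 0), k t != 0 &
      derivable k t 1 /\ graph_defect (k t) (derive1 k t) (c t) (derive1 c t) = 0].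
  move=> JJ' rep J't; have [oJ' _ /(_ t J't)[/chart_domE rz _]] := rep.
  by split=> //; apply: (integral_curve_chart oJ' (integral_curve_sub JJ' hgam) rep).
split.
- move=> t Jt; have [i [J' [c [J't JJ' rep]]]] := integral_curve_chart_rep oJ hgam Jt.
  split; last by exists i, J', c.
  by apply/M4_charts; exists i, (c t); have [_ _ /(_ t J't)] := rep.
- move=> i J' c JJ' rep t J't; have [rz [_ [c2 c3] x0 k0 _]] := key i J' c t JJ' rep J't.
  rewrite lsubmx_eq0 x0 rsubmx_eq0; split=> //; apply: contra_neq x0 => -[y0 y1].
  rewrite y0 in c2; rewrite y1 in c3.
  have t0 : turn0 (c t) (derive1 c t) = 0 by apply: (mulfI k0); rewrite mulr0 -c2.
  have t1 : turn1 (c t) (derive1 c t) = 0 by apply: (mulfI k0); rewrite mulr0 -c3.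
  by have [-> ->] := turn_eq0 rz t0 t1.
- move=> i J' c JJ' rep t J't; have [rz [_ gr _ _ _]] := key i J' c t JJ' rep J't.
  rewrite dancing_metricE //.
  have [_ nul] := null_graph_plane (slope i gam t) rz.
  by apply: nul; exact/mem_graph_plane.
- move=> i J' c JJ' rep; have [oJ' sc _] := rep.
  exists (fun t => graph_plane (c t) (slope i gam t)); split=> [t J't|V sV VW t J't].
    have [rz [_ gr _ _ _]] := key i J' c t JJ' rep J't.
    by rewrite dancing_metricE //; split; [exact: SD_graph_plane | exact/mem_graph_plane].
  have [rz [_ gr _ _ [dk dk0]]] := key i J' c t JJ' rep J't.
  have VW' s : J' s -> in_graph (c s) (slope i gam s) (V s) by move=> /VW /mem_graph_plane.
  have /= [] := cov_deriv_graph i oJ' J't rz (smooth_on_derivable sc J't)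
    (smooth_on_derivable sV J't) dk VW' gr.
  rewrite dk0 !mul0r => d2 d3; apply/mem_graph_plane.
  by split; apply/eqP; rewrite -subr_eq0; [rewrite d2 | rewrite d3].
Qed.

Lemma scale_eqs (n m r : R) : n * m * r = 1 ->
  m ^+ 2 / n = m ^+ 3 * r /\ n = (m * r)^-1.
Proof.
move=> e; have : n * m * r != 0 by rewrite e oner_eq0.
rewrite !mulf_eq0 !negb_or -andbA => /and3P[n0 m0 r0].
have nE : n = (m * r)^-1 by apply: (mulIf (mulf_neq0 m0 r0)); rewrite mulrA e mulVf ?mulf_neq0.
by split=> //; rewrite nE; field; rewrite r0 m0.
Qed.

(** A chart representation of one projection also represents the other, so both curves have the same
    chart velocity, hence the same slope at t; injectivity of the cube then gives the same mu. *)
Lemma integral_curve_inj J gam1 gam2 : open J ->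
  integral_curve J gam1 -> integral_curve J gam2 ->
  (forall t, J t -> Pi (gam1 t) = Pi (gam2 t)) -> forall t, J t -> gam1 t = gam2 t.
Proof.
move=> oJ h1 h2 e12 t Jt.
have [i [J' [c [J't JJ' rep1]]]] := integral_curve_chart_rep oJ h1 Jt.
have [oJ' sc rep] := rep1.
have rep2 : chart_rep (@Pi R \o gam2) i J' c.
  by split=> // s J's; have [ds <-] := rep s J's; split=> //; rewrite /= e12 //; exact: JJ'.
have [/chart_domE rz _] := rep t J't.
have [m1 g1 x0 _ _] := integral_curve_chart oJ' (integral_curve_sub JJ' h1) rep1 J't.
have [m2 g2 _ _ _] := integral_curve_chart oJ' (integral_curve_sub JJ' h2) rep2 J't.
have sl := in_graph_inj rz x0 g1 g2.
have [_ _ h1t] := h1; have [Q1 _ _] := h1t t Jt.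
have [_ _ h2t] := h2; have [Q2 _ _] := h2t t Jt.
have [_ P1] := rep t J't; have [_ _ /(_ t J't)[_ P2]] := rep2.
have [-> _] := Pi_chart Q1 P1; have [-> _] := Pi_chart Q2 P2.
have [s1 n1] := scale_eqs m1; have [s2 n2] := scale_eqs m2.
have m12 : (gam1 t).1 i 0 = (gam2 t).1 i 0.
  apply: expr3_inj; apply: (mulIf rz); rewrite -s1 -s2.
  by apply: (mulfI (chart_sign_neq0 i)); rewrite [LHS]mulrA [RHS]mulrA; exact: sl.
by rewrite n1 n2 m12.
Qed.

Lemma ins_ind (T : Type) (P : (T -> R) -> Prop) i (k : 'I_3) (s a b : T -> R) :
  P s -> P a -> P b -> P (fun t => nth 0 (ins i (s t) (a t) (b t)) k).
Proof. by case: i => [[|[|[|//]]] ?]; case: k => [[|[|[|//]]] ?]. Qed.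

Lemma smooth_on_row3_ins i J (s a b : R -> R) : open J ->
  smooth_on J s -> smooth_on J a -> smooth_on J b ->
  smooth_on J (fun t => row3 (ins i (s t) (a t) (b t))).
Proof.
move=> oJ ss sa sb; apply: (iffRL (smooth_on_mx _ oJ)) => j k.
have -> : (fun t => row3 (ins i (s t) (a t) (b t)) j k) =
    fun t => nth 0 (ins i (s t) (a t) (b t)) k.
  by apply/funext => t; rewrite mxE.
exact: (@ins_ind _ (smooth_on J)).
Qed.

Lemma smooth_on_col3_ins i J (s a b : R -> R) : open J ->
  smooth_on J s -> smooth_on J a -> smooth_on J b ->
  smooth_on J (fun t => col3 (ins i (s t) (a t) (b t))).
Proof.
move=> oJ ss sa sb; apply: (iffRL (smooth_on_mx _ oJ)) => k j.
have -> : (fun t => col3 (ins i (s t) (a t) (b t)) k j) =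
    fun t => nth 0 (ins i (s t) (a t) (b t)) k.
  by apply/funext => t; rewrite mxE.
exact: (@ins_ind _ (smooth_on J)).
Qed.

Lemma null_curve_lift Gam i J c : chart_rep Gam i J c ->
  (forall t, J t -> lsubmx (derive1 c t) != 0 /\ rsubmx (derive1 c t) != 0) ->
  (exists W : R -> {vspace 'rV[R]_(2 + 2)},
    (forall t, J t ->
       SD_null_plane (dancing_metric i (c t)) (W t) /\ derive1 c t \in W t) /\
    parallel_along (dancing_metric i) J c W) ->
  exists gam, integral_curve J gam /\ forall t, J t -> Pi (gam t) = Gam t.
Proof.
move=> [oJ sc rep] ndeg [W [SDW parW]].
have rz t (Jt : J t) : rho (c t) != 0 by have [/chart_domE] := rep t Jt.
pose v : R -> 'rV[R]_(2 + 2) := derive1 c.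
have v0 t (Jt : J t) : (co (v t) 0, co (v t) 1) != (0, 0).
  by have [+ _] := ndeg t Jt; rewrite lsubmx_eq0.
have graph t : J t -> exists k, forall w, w \in W t -> in_graph (c t) k w.
  move=> Jt; have [SDt vW] := SDW t Jt; rewrite dancing_metricE ?rz // in SDt.
  exact: (SD_null_plane_graph (rz t Jt) SDt vW (v0 t Jt)).
pose T0 t := turn0 (c t) (v t); pose T1 t := turn1 (c t) (v t).
pose N t := T0 t * T0 t + T1 t * T1 t.
have N0 t : J t -> N t != 0.
  move=> Jt; rewrite /N -!expr2 paddr_eq0 ?sqr_ge0 // !sqrf_eq0.
  apply/negP => /andP[/eqP t0 /eqP t1].
  by have [e0 e1] := turn_eq0 (rz t Jt) t0 t1; have := v0 t Jt; rewrite e0 e1 eqxx.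
(* The planes W t provide k only point by point. Projecting y' orthogonally on the turned x' gives
   the same number by a formula rational in c and c', hence smooth. *)
pose k t := (co (v t) 2 * T0 t + co (v t) 3 * T1 t) * (N t)^-1.
have kW t w : J t -> w \in W t -> in_graph (c t) (k t) w.
  move=> Jt; have [k' gk'] := graph t Jt; have [_ vW] := SDW t Jt.
  suff -> : k t = k' by exact: gk'.
  have [e2 e3] := gk' _ vW; rewrite /k e2 e3 -/(T0 t) -/(T1 t).
  by move: (N0 t Jt); rewrite /N => n0; field.
have gk t (Jt : J t) : in_graph (c t) (k t) (v t) by have [_ /(kW t _ Jt)] := SDW t Jt.
have sco n : smooth_on J (fun t => co (c t) n) by exact: (iffLR (smooth_on_mx _ oJ) sc).
have sv : smooth_on J v := smooth_on_derive1 sc.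
have scv n : smooth_on J (fun t => co (v t) n) by exact: (iffLR (smooth_on_mx _ oJ) sv).
have sA : smooth_on J (fun t => area (c t) (v t)) := smooth_onD oJ
  (smooth_onM oJ (sco 1%N) (scv 0%N)) (smooth_onN oJ (smooth_onM oJ (sco 0%N) (scv 1%N))).
have sT0 : smooth_on J T0 :=
  smooth_onD oJ (smooth_onN oJ (scv 1%N)) (smooth_onM oJ (sco 2%N) sA).
have sT1 : smooth_on J T1 := smooth_onD oJ (scv 0%N) (smooth_onM oJ (sco 3%N) sA).
have sN : smooth_on J N := smooth_onD oJ (smooth_onM oJ sT0 sT0) (smooth_onM oJ sT1 sT1).
have sk : smooth_on J k := smooth_onM oJ
  (smooth_onD oJ (smooth_onM oJ (scv 2%N) sT0) (smooth_onM oJ (scv 3%N) sT1))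
  (smooth_onV oJ N0 sN).
have srho : smooth_on J (fun t => rho (c t)) := smooth_onD oJ
  (smooth_onD oJ (@smooth_on_cst R J 1) (smooth_onM oJ (sco 0%N) (sco 2%N)))
  (smooth_onM oJ (sco 1%N) (sco 3%N)).
have k0 t : J t -> k t != 0.
  move=> Jt; apply/eqP => kt0; have [_] := ndeg t Jt; rewrite rsubmx_eq0.
  by have [-> ->] := gk t Jt; rewrite kt0 !mul0r eqxx.
have defect t : J t -> graph_defect (k t) (derive1 k t) (c t) (v t) = 0.
  move=> Jt; have [_ vW] := SDW t Jt.
  have /kW - /(_ Jt) [D2 D3] := parW v sv (fun s Js => proj2 (SDW s Js)) t Jt.
  have /= [] := cov_deriv_graph i oJ Jt (rz t Jt) (smooth_on_derivable sc Jt)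
    (smooth_on_derivable sv Jt) (smooth_on_derivable sk Jt) gk (gk t Jt).
  rewrite D2 D3 !subrr => /esym/eqP + /esym/eqP; rewrite !mulf_eq0.
  case: eqP => //= _ /eqP t0 /eqP t1; have [e0 e1] := turn_eq0 (rz t Jt) t0 t1.
  by have := v0 t Jt; rewrite e0 e1 eqxx.
pose mu t := cbrt (chart_sign i * k t * (rho (c t))^-1).
pose nu t := (mu t * rho (c t))^-1.
have f0 t : J t -> chart_sign i * k t * (rho (c t))^-1 != 0.
  move=> Jt; apply: mulf_neq0; last by rewrite invr_eq0 rz.
  by apply: mulf_neq0; [exact: chart_sign_neq0 | exact: k0].
have m0 t : J t -> mu t != 0 by move=> Jt; rewrite cbrt_eq0 f0.
have sf : smooth_on J (fun t => chart_sign i * k t * (rho (c t))^-1) := smooth_onM oJ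
  (smooth_onM oJ (@smooth_on_cst R J (chart_sign i)) sk) (smooth_onV oJ rz srho).
have smu : smooth_on J mu := smooth_on_cbrt oJ f0 sf.
have mr0 t : J t -> mu t * rho (c t) != 0 by move=> Jt; rewrite mulf_neq0 ?m0 ?rz.
have snu : smooth_on J nu := smooth_onV oJ mr0 (smooth_onM oJ smu srho).
pose gam t : ambient R :=
  (col3 (ins i (mu t) (mu t * co (c t) 0) (mu t * co (c t) 1)),
   row3 (ins i (nu t) (nu t * co (c t) 2) (nu t * co (c t) 3))).
have gamE t : gam t = (mu t *: chart_q i (c t), nu t *: chart_p i (c t)).
  by rewrite chart_qE chart_pE scale_col3_ins scale_row3_ins !mulr1.
have numu t : J t -> nu t * mu t * rho (c t) = 1.
  by move=> Jt; rewrite /nu -mulrA mulVf // mr0.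
exists gam; split=> [|t Jt]; last first.
  have [_ ->] := rep t Jt; rewrite gamE /chart /Pi /=.
  have n0 : nu t != 0 by rewrite invr_eq0 mr0.
  by rewrite !vline_scale ?m0.
split=> [||t Jt].
- exact: smooth_on_col3_ins oJ smu (smooth_onM oJ smu (sco 0%N)) (smooth_onM oJ smu (sco 1%N)).
- exact: smooth_on_row3_ins oJ snu (smooth_onM oJ snu (sco 2%N)) (smooth_onM oJ snu (sco 3%N)).
have dc := smooth_on_derivable sc Jt; have dk := smooth_on_derivable sk Jt.
have dmu := smooth_on_derivable smu Jt; have dnu := smooth_on_derivable snu Jt.
have gamE' s (_ : J s) : gam s = _ := erefl (gam s).
split.
- by rewrite gamE /Q5 /= pairingZl pairingZr rhoE mulrA numu.
- rewrite (velocity_lift oJ Jt dc dmu dnu gamE'); apply/eqP => e.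
  have := congr1 (fun Q : ambient R => Q.1^T) e; rewrite -(ins0 i) /= -!tr_row3 !trmxK.
  move=> /row3_ins_inj[-> e0 e1]; rewrite mulr0 addr0 in e0; rewrite mulr0 addr0 in e1.
  have := v0 t Jt; rewrite /v (mulfI (m0 t Jt) (etrans e0 (esym (mulr0 _)))).
  by rewrite (mulfI (m0 t Jt) (etrans e1 (esym (mulr0 _)))) eqxx.
apply/(distr_lift oJ Jt dc dmu dnu gamE'); rewrite -/(v t).
set m := mu t; set n := nu t; set r := rho (c t); set K := k t.
set dm : R := derive1 mu t; set dn : R := derive1 nu t.
set A := area (c t) (v t); set B := co (c t) 2 * co (v t) 0 + co (c t) 3 * co (v t) 1.
have [y0 y1] := gk t Jt.
have drE : drho (c t) (v t) = B + K * r * A.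
  by rewrite /drho y0 y1 /B /A /r /K /turn0 /turn1 /area /rho; ring.
have dkE : derive1 k t = K * (K * A - 2 * B / r).
  by apply/eqP; rewrite -subr_eq0; apply/eqP; exact: defect.
have r0 : r != 0 := rz t Jt; have mn0 : m != 0 := m0 t Jt.
have hr := is_derive_rho_curve dc; rewrite -/(v t) drE in hr.
have hk := is_derive_derive1 dk; rewrite dkE in hk.
have hf := is_derive_mulf
  (is_derive_mulf (is_derive_cst (chart_sign i : R) t 1) hk)
  (is_derive_invf (h := fun s => rho (c s)) r0 hr).
have hm := is_derive_cbrtf (f := fun s => chart_sign i * k s * (rho (c s))^-1) (f0 t Jt) hf.
have m3 : chart_sign i * K = m ^+ 3 * r by rewrite /m /mu cbrtK -/r -/K divfK.
(* Logarithmic derivative of [m3]: 3 mu' / mu = k' / k - rho' / rho, in which the terms K A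
   cancel. *)
have dmE : dm = - (m * B) / r.
  rewrite /dm (is_derive_derive1E hm) -/(mu t) -/m /= -/r -/K m3.
  have -> : chart_sign i * (K * (K * A - 2 * B / r)) = m ^+ 3 * r * (K * A - 2 * B / r).
    by rewrite mulrA m3.
  by clearbody m r A B K; rewrite mulr0 addr0; field; rewrite r0 mn0.
have nE : n = (m * r)^-1 by [].
have hn := is_derive_invf (h := fun s => mu s * rho (c s)) (mr0 t Jt)
  (is_derive_mulf (is_derive_derive1 dmu) hr).
(* In nu' / nu = - mu' / mu - rho' / rho it is now the terms B / r that cancel. *)
have dnE : dn = - (K * A) / (m * r).
  rewrite /dn (is_derive_derive1E hn) -/(mu t) -/m -/dm -/r dmE.
  by clearbody m r A B K; field; rewrite r0 mn0.
rewrite dmE dnE nE y0 y1 -/K.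
move: (turn0 _ _) (turn1 _ _) => t0 t1.
have KE : K = chart_sign i * m ^+ 3 * r by rewrite -mulrA -m3 mulrA chart_sign_sqr mul1r.
by rewrite KE -/B; clearbody m r A B; split; field; rewrite ?r0 ?mn0.
Qed.

(** A local lift is chosen around each t, and [gam t] is the value at t of the lift chosen there. By
    uniqueness on intersections of domains, [gam] coincides with each chosen lift on its whole
    domain, so smoothness and velocity can be read off locally. *)
Lemma null_curve_lifts Gam J : open J ->
  nondegenerate_null_curve_with_parallel_SD_plane J Gam ->
  exists gam, integral_curve J gam /\ forall t, J t -> Pi (gam t) = Gam t.
Proof.
move=> oJ [sG ndeg _ par].
have loc t : J t -> exists gJ : (R -> ambient R) * set R,
    [/\ open gJ.2, gJ.2 t, gJ.2 `<=` J, integral_curve gJ.2 gJ.1 &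
        forall s, gJ.2 s -> Pi (gJ.1 s) = Gam s].
  move=> Jt; have [_ [i [J' [c [J't JJ' rep]]]]] := sG t Jt.
  have [gam [hgam pgam]] := null_curve_lift rep (ndeg i J' c JJ' rep) (par i J' c JJ' rep).
  by exists (gam, J'); split=> //; have [] := rep.
(* Outside J the pair is a mere default value. *)
pose sel t := if pselect (J t) is left Jt then projT1 (cid (loc t Jt)) else (fun=> 0, set0).
have selP t : J t -> [/\ open (sel t).2, (sel t).2 t, (sel t).2 `<=` J,
    integral_curve (sel t).2 (sel t).1 & forall s, (sel t).2 s -> Pi ((sel t).1 s) = Gam s].
  by move=> Jt; rewrite /sel; case: pselect => // Jt'; case: (cid _).
pose gam t := (sel t).1 t.
have gamE t s : J t -> (sel t).2 s -> gam s = (sel t).1 s.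
  move=> Jt Js; have [op1 _ JJ h1 p1] := selP t Jt.
  have [op2 s2 _ h2 p2] := selP s (JJ s Js).
  apply: (@integral_curve_inj ((sel t).2 `&` (sel s).2) (sel s).1 (sel t).1); last by split.
  - exact: openI.
  - exact: integral_curve_sub (@subIsetr _ _ _) h2.
  - exact: integral_curve_sub (@subIsetl _ _ _) h1.
  - by move=> u [u1 u2]; rewrite p1 // p2.
exists gam; split=> [|t Jt]; last by have [_ st _ _ p] := selP t Jt; exact: p.
have smooth_loc (V : normedModType R) (f : ambient R -> V) :
    (forall t, J t -> smooth_on (sel t).2 (f \o (sel t).1)) -> smooth_on J (f \o gam).
  move=> h n t Jt; have [op st _ _ _] := selP t Jt.
  apply: (eq_smooth_on op _ (h t Jt)) => // s; rewrite inE => ss.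
  by rewrite /= (gamE t).
split=> [||t Jt].
- by apply: smooth_loc => t Jt; have [_ _ _ [sq _ _] _] := selP t Jt; exact: sq.
- by apply: smooth_loc => t Jt; have [_ _ _ [_ sp _] _] := selP t Jt; exact: sp.
have [op st _ [_ _ /(_ t st) h] _] := selP t Jt.
have -> : velocity gam t = velocity (sel t).1 t.
  by congr (_, _); apply: (eq_derive1 op) => // s; rewrite inE => ss; rewrite /= (gamE t).
by [].
Qed.

End Main.

Theorem theorem1p4 (R : realType) (I : set R)
    (openI : open I) (intervalI : is_interval I) (I_neq0 : I !=set0) :
  [/\ forall gam : R -> ambient R, integral_curve I gam ->
        nondegenerate_null_curve_with_parallel_SD_plane I (@Pi R \o gam),
      forall gam1 gam2 : R -> ambient R,
        integral_curve I gam1 -> integral_curve I gam2 ->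
        (forall t, I t -> Pi (gam1 t) = Pi (gam2 t)) ->
        forall t, I t -> gam1 t = gam2 t
    & forall Gam : R -> planes R,
        nondegenerate_null_curve_with_parallel_SD_plane I Gam ->
        exists gam : R -> ambient R,
          integral_curve I gam /\ forall t, I t -> Pi (gam t) = Gam t].
Proof.
split.
- by move=> gam; exact: integral_curve_projects.
- by move=> gam1 gam2; exact: integral_curve_inj.
- by move=> Gam; exact: null_curve_lifts.
Qed.
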